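(* Let $X$ and $Y$ be Souslin spaces, $\mu\in\mathcal P(X)$, $\nu\in\mathcal P(Y)$. Let $F\colon Y\to\mathbb R^d$ be a Borel measurable function integrable with respect to $\nu$, let $g(p)=\int_Y F(y)\,p(dy)$, and let $h\colon X\times\mathbb R^d\to\mathbb R$ be a Borel measurable function. Consider the nonlinear Kantorovich problem $$ \int_X h(x,g(\sigma^x))\,\mu(dx)\to\inf,\qquad \sigma\in\Pi(\mu,\nu),\quad \sigma(dx\,dy)=\sigma^x(dy)\,\mu(dx), \qquad (\mathrm{K}) $$ and the Monge problem with convex dominance $$ \int_X h(x,T(x))\,\mu(dx)\to\inf,\qquad T\colon X\to\mathbb R^d \text{ Borel measurable},\quad \mu\circ T^{-1}\preceq_c\nu\circ F^{-1}. \qquad (\mathrm{M}) $$ Then: (i) the infima in the two problems coincide: $$ \inf_{\sigma\in\Pi(\mu,\nu)}\int_X h(x,g(\sigma^x))\,\mu(dx)=\inf_{T\colon X\to\mathbb R^d,\ \mu\circ T^{-1}\preceq_c\nu\circ F^{-1}}\int_X h(x,T(x))\,\mu(dx); $$ (ii) there exists a minimum in problem (K) if and only if there exists a minimum in problem (M).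
   Context: A Souslin space is a (Hausdorff) image of a Polish space under a continuous mapping. $\mathcal P(Z)$ is the set of Radon probability measures on $Z$ (on Souslin spaces all Borel probability measures are Radon). $\Pi(\mu,\nu)$ is the set of probability measures on $X\times Y$ with projections $\mu$ on $X$ and $\nu$ on $Y$. For $\sigma\in\Pi(\mu,\nu)$, the measures $\sigma^x\in\mathcal P(Y)$, $x\in X$, are the conditional measures (disintegration) of $\sigma$ with respect to $\mu$: $x\mapsto\sigma^x(B)$ is $\mu$-measurable for each Borel $B\subset Y$, and $\int_{X\times Y}\varphi(x)\psi(y)\,\sigma(dx\,dy)=\int_X\int_Y\varphi(x)\psi(y)\,\sigma^x(dy)\,\mu(dx)$ for all bounded Borel $\varphi,\psi$; this is written $\sigma(dx\,dy)=\sigma^x(dy)\,\mu(dx)$. The quantity $g(p)$ is defined for those $p$ for which $F$ is $p$-integrable; for $\sigma\in\Pi(\mu,\nu)$ this holds for $p=\sigma^x$ for $\mu$-a.e. $x$. $\mu\circ T^{-1}$ is the image (push-forward) measure. For $\alpha,\beta\in\mathcal P(\mathbb R^d)$, $\alpha\preceq_c\beta$ (convex order) means that both measures have finite first moments and $\int\varphi\,d\alpha\le\int\varphi\,d\beta$ for every convex function $\varphi\colon\mathbb R^d\to\mathbb R$ integrable with respect to $\beta$. Infima are over those admissible $\sigma$, respectively $T$, for which the integral is well defined in $[-\infty,+\infty]$ (this is no restriction if, for instance, $h\ge 0$). *)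

(* Defs.v *)
From HB Require Import structures.
From mathcomp Require Import all_boot all_order all_algebra.
From mathcomp Require Import all_classical all_reals all_analysis.
From mathcomp Require Import measurable_realfun.

Set Implicit Arguments.
Unset Strict Implicit.
Unset Printing Implicit Defensive.
Import Order.TTheory GRing.Theory Num.Theory.
Import numFieldNormedType.Exports.

Local Open Scope classical_set_scope.
Local Open Scope ring_scope.

(* [P] ranges over complete Hausdorff spaces whose uniformity is given by a
   family of balls indexed by [R]: such a space is completely metrizable, and
   every complete metric space carries this structure. *)
Definition souslin (R : realType) (Z : topologicalType) : Prop :=
  hausdorff_space Z /\
  exists (P : completePseudoMetricType R) (f : P -> Z),
    [/\ hausdorff_space P,
        exists2 D : set P, countable D & dense D,
        continuous f
      & range f = [set: Z]].

(* The measurable structure that the library puts on a product is the product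
   sigma-algebra, so on [X * Y] it is [borel (X * Y)] that denotes the Borel
   sets of the product topology. *)
Notation borel Z := (g_sigma_algebraType (@open Z)).

Section defs.
Context (R : realType).

(* Measurability with respect to the completion of the sigma-algebra by the
   [mu]-negligible sets. *)
Definition mu_measurable d (T : measurableType d) (mu : set T -> \bar R)
    (f : T -> \bar R) : Prop :=
  measurable_fun
    [set: g_sigma_algebraType (completed_algebra_gen mu)] f.

(* For a [mu]-measurable [f] that is not measurable, the library's
   [\int[mu]_x f x], a difference of suprema over measurable simple functions,
   still agrees with the integral of any measurable version of [f]. *)
Definition integral_defined d (T : measurableType d) (mu : set T -> \bar R)
    (f : T -> \bar R) : Prop :=
  mu_measurable mu f /\
  ((\int[mu]_x (f^\+ x) < +oo)%E \/ (\int[mu]_x (f^\- x) < +oo)%E).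

Definition has_minimum (I : Type) (A : set I) (J : I -> \bar R) : Prop :=
  exists2 i, A i & forall j, A j -> (J i <= J j)%E.

(* The norm on ['rV[R]_d] is the sup norm. *)
Definition finite_first_moment d (a : probability (borel 'rV[R]_d) R) : Prop :=
  a.-integrable setT (fun v => `|v : 'rV[R]_d|%:E).

Definition convex_order d (a b : probability (borel 'rV[R]_d) R) : Prop :=
  [/\ finite_first_moment a, finite_first_moment b
    & forall phi : 'rV[R]_d -> R,
        convex_function [set: convex_lmodType 'rV[R]_d] phi ->
        b.-integrable setT (fun v => (phi v)%:E) ->
        (\int[a]_v (phi v)%:E <= \int[b]_v (phi v)%:E)%E].

Context (X Y : ptopologicalType) (d : nat).
Context (mu : probability (borel X) R) (nu : probability (borel Y) R).
Context (F : {mfun borel Y >-> borel 'rV[R]_d}).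

Definition vintegrable (p : probability (borel Y) R) : Prop :=
  forall i, p.-integrable setT (fun y => (F y ord0 i)%:E).

(* Only meaningful for [p] with [vintegrable p]; the coordinates for which the
   integral is not finite receive the value 0. *)
Definition barycenter (p : probability (borel Y) R) : 'rV[R]_d :=
  \row_i \int[p]_y (F y ord0 i).

Definition transport_plan (s : probability (borel (X * Y)%type) R) : Prop :=
  (forall A : set (borel X), measurable A ->
     pushforward s (fst : borel (X * Y)%type -> borel X) A = mu A) /\
  (forall B : set (borel Y), measurable B ->
     pushforward s (snd : borel (X * Y)%type -> borel Y) B = nu B).

Definition disintegration (s : probability (borel (X * Y)%type) R)
    (k : X -> probability (borel Y) R) : Prop :=
  (forall B : set (borel Y), measurable B -> mu_measurable mu (fun x => k x B)) /\
  (forall (phi : borel X -> R) (psi : borel Y -> R),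
     measurable_fun setT phi -> measurable_fun setT psi ->
     bounded_fun phi -> bounded_fun psi ->
     (\int[s]_z (phi z.1 * psi z.2)%:E =
      \int[mu]_x \int[k x]_y (phi x * psi y)%:E)%E).

Context (h : borel (X * 'rV[R]_d)%type -> R).

Definition integrand (T : X -> 'rV[R]_d) : borel X -> \bar R :=
  fun x => (h (x, T x))%:E.

Definition monge_cost (T : X -> 'rV[R]_d) : \bar R :=
  (\int[mu]_x integrand T x)%E.

Definition monge_admissible : set {mfun borel X >-> borel 'rV[R]_d} :=
  [set T | convex_order (distribution mu T) (distribution nu F) /\
           integral_defined mu (integrand T)].

Definition kantorovich_map
    (sk : probability (borel (X * Y)%type) R * (X -> probability (borel Y) R)) :
    X -> 'rV[R]_d :=
  fun x => barycenter (sk.2 x).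

(* The plans are paired with their disintegrations: conditional measures are
   unique only up to a [mu]-negligible set, on which the cost does not depend. *)
Definition kantorovich_admissible :
    set (probability (borel (X * Y)%type) R * (X -> probability (borel Y) R)) :=
  [set sk | [/\ transport_plan sk.1, disintegration sk.1 sk.2
             & integral_defined mu (integrand (kantorovich_map sk))]].

Definition kantorovich_cost
    (sk : probability (borel (X * Y)%type) R * (X -> probability (borel Y) R)) :
    \bar R :=
  (\int[mu]_x integrand (kantorovich_map sk) x)%E.

End defs.

(* Main.v *)
(* Both problems have the same set of values, each admissible object of one
   being matched with an admissible object of the other whose integrand agrees
   almost everywhere.

   If [s] is a plan with conditional measures [k x], then [T x := g (k x)] has
   law dominated by the law of [F]: Jensen's inequality gives
   [phi (T x) <= \int phi(F) d(k x)], which is integrated in [x].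

   Conversely, let the law of [T] be dominated by the law of [F].  On functions
   [u (x, y)] dominated by an integrable function of [y], consider the sublinear
   functional [p u], the infimum of [\int psi d nu] over all [psi] with
   [u (x, y) <= psi y].  On the functions [a x + b x . F y] the functional
   [\int (a + b . T) d mu] is below [p], because [z |-> sup_x (a x + b x . z)]
   is convex.  A Hahn-Banach extension [L] defines the bimeasure
   [sigma A B := L (1_A 1_B)], which has marginals [mu] and [nu] and is
   countably additive in each variable as it is dominated by them.  Tightness of
   [nu] gives a Borel injection of almost all of [Y] into [[0, 1]] with a Borel
   left inverse; Radon-Nikodym densities of [sigma] at the rational levels are
   conditional distribution functions, and their quantile function realizes
   [sigma] by a measurable map [H] on [X * [0, 1]].  The laws of [H (x, .)] are
   the conditional measures sought, since
   [L (1_A F) = \int_A T d mu] for every [A]. *)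

Require Import Defs.
From HB Require Import structures.
From mathcomp Require Import all_boot all_order all_algebra.
From mathcomp Require Import all_classical all_reals all_analysis.
From mathcomp Require Import measurable_realfun ring lra.

Set Implicit Arguments.
Unset Strict Implicit.
Unset Printing Implicit Defensive.
Import Order.TTheory GRing.Theory Num.Theory.
Import numFieldNormedType.Exports.

Local Open Scope classical_set_scope.
Local Open Scope ring_scope.

(** * Hahn-Banach *)

(** The functional given by Hahn-Banach is only finitely additive on functions of [(x, y)]. Measures
    are therefore drawn from it in one variable at a time, where domination by [mu] or [nu] forces
    countable additivity, and a measure on the product comes only afterwards, from the quantile map.
    For the same reason [L (1_A g)] with unbounded [g] is not at once an integral: simple functions
    below [g] give one inequality, and it is an equality because the values for [A] and its
    complement add up to the integral of [g]. Realizing the coupling by a map on [X * [0, 1]] lets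
    the plan, its conditional measures and their measurability in [x] all come from Fubini. The
    Souslin property acts through countable covers, which make the open sets of a product measurable
    for the product sigma-algebra, and through tightness, which makes decoding a Borel map. From
    plans to maps the difficulty is that conditional measures are measurable in [x] only for the
    completion of [mu]: functions of [x] are replaced by Borel versions, and integrals of possibly
    non-measurable functions must be shown to respect almost everywhere equality. *)

Section hahn_banach.
Context (R : realType) (V : lmodType R) (E : set V) (p : V -> R).
Hypothesis E_lin : forall t u v, E u -> E v -> E (t *: u + v).
Hypothesis p_add : forall u v, E u -> E v -> p (u + v) <= p u + p v.
Hypothesis p_scale : forall t u, 0 < t -> E u -> p (t *: u) <= t * p u.

(** A partial functional is represented by its graph, so that extension is inclusion; that the graph
    is single-valued follows from domination by [p]. *)
Definition dominated_graph (G : set (V * R)) :=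
  [/\ G (0, 0),
      forall t u v r s, G (u, r) -> G (v, s) -> G (t *: u + v, t * r + s)
    & forall u r, G (u, r) -> E u /\ r <= p u].

(** Zorn's lemma is applied to the sets whose union with [G0] is dominated, so that the empty chain
    is covered too; the alternative [Z = set0] accounts for points that lie in [G0] only. *)
Lemma dominated_graph_bigcup (G0 : set (V * R)) (C : set (set (V * R))) :
  dominated_graph G0 -> C `<=` [set G | dominated_graph (G `|` G0)] ->
  total_on C subset -> dominated_graph (\bigcup_(G in C) G `|` G0).
Proof.
move=> G0d Cd Ctot.
have CE : forall e, (\bigcup_(G in C) G `|` G0) e ->
    exists Z, (C Z \/ Z = set0) /\ (Z `|` G0) e.
  move=> e [[Z CZ Ze]|G0e]; first by exists Z; split; left.
  by exists set0; split; right.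
have Zd : forall Z, C Z \/ Z = set0 -> dominated_graph (Z `|` G0).
  by move=> Z [/Cd//|->]; rewrite set0U.
have ZC : forall Z, C Z \/ Z = set0 ->
    Z `|` G0 `<=` \bigcup_(G in C) G `|` G0.
  by move=> Z [CZ|->] x [Zx|G0x]//; [left; exists Z|right|right].
split; first by right; case: G0d.
- move=> t u v r s /CE[Z1 [CZ1 h1]] /CE[Z2 [CZ2 h2]].
  have [Z [CZ Z1Z Z2Z]] : exists Z, [/\ C Z \/ Z = set0, Z1 `<=` Z & Z2 `<=` Z].
    case: CZ1 => [CZ1|->]; last by exists Z2; split.
    case: CZ2 => [CZ2|->]; last by exists Z1; split => //; left.
    have [Z12|Z21] := Ctot _ _ CZ1 CZ2; first by exists Z2; split => //; left.
    by exists Z1; split => //; left.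
  apply: (ZC _ CZ); have [_ Zlin _] := Zd _ CZ.
  by apply: Zlin; [case: h1 => [/Z1Z|]|case: h2 => [/Z2Z|]]; by [left|right].
- by move=> u r /CE[Z [CZ h]]; have [_ _] := Zd _ CZ; apply.
Qed.

(** The value [c] at [v0] has to satisfy [r - p (m - v0) <= c <= p (m' + v0) - r'] for all [(m, r)]
    and [(m', r')] in [G]. Subadditivity puts every left side below every right side, and [c] is the
    supremum of the left sides. *)
Lemma dominated_graph_extend (G : set (V * R)) v0 : dominated_graph G -> E v0 ->
  exists c, dominated_graph
    [set e | exists u r t, G (u, r) /\ e = (u + t *: v0, r + t * c)].
Proof.
move=> [G0 Glin Gp] Ev0.
have E0 : E 0 by have [] := Gp _ _ G0.
have Ev m t : E m -> E (m + t *: v0) by move=> Em; rewrite addrC; apply: E_lin.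
pose S := [set x | exists m r, G (m, r) /\ x = r - p (m - v0)].
have Sub m' r' : G (m', r') -> ubound S (p (m' + v0) - r').
  move=> G' _ [m [r [Gm ->]]]; rewrite lerBlDr addrAC lerBrDr.
  have [Em _] := Gp _ _ Gm; have [Em' _] := Gp _ _ G'.
  have := Glin 1 _ _ _ _ Gm G'; rewrite scale1r mul1r => /Gp[_ h].
  have := Ev m (-1) Em; rewrite scaleN1r => Emv.
  have := Ev m' 1 Em'; rewrite scale1r => Emv'.
  have := p_add Emv Emv'; rewrite addrACA addNr addr0 => h2.
  by rewrite (le_trans h)// (le_trans h2)// addrC.
have hsS : has_sup S.
  split; first by exists (0 - p (0 - v0)), 0, 0.
  by exists (p (0 + v0) - 0); exact: Sub.
exists (sup S); split.
- by exists 0, 0, 0; rewrite scale0r mul0r !addr0.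
- move=> t _ _ _ _ [u1 [r1 [t1 [G1 [-> ->]]]]] [u2 [r2 [t2 [G2 [-> ->]]]]].
  exists (t *: u1 + u2), (t * r1 + r2), (t * t1 + t2); split; first exact: Glin.
  congr (_, _); last by ring.
  by rewrite scalerDr scalerDl scalerA addrACA.
- move=> _ _ [u [r [t [Gur [-> ->]]]]]; have [Eu rp] := Gp _ _ Gur.
  split; first exact: Ev.
  have Gs s : G (s *: u, s * r) by have := Glin s _ _ _ _ Gur G0; rewrite !addr0.
  (* Division by [|t|] reduces the bound to [t = -1], where [sup S] is above the elements of [S], or
     to [t = 1], where it is below their upper bounds. *)
  case: (ltrgtP t 0) => [t0|t0|->]; last by rewrite scale0r mul0r !addr0.
  + have k0 : 0 < - t by lra.
    have : S ((- t)^-1 * r - p ((- t)^-1 *: u - v0)).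
      by exists ((- t)^-1 *: u), ((- t)^-1 * r); split => //; apply: Gs.
    move=> /(ub_le_sup hsS.2) h.
    have kE : (- t)^-1 *: u - v0 = (- t)^-1 *: (u + t *: v0).
      by rewrite scalerDr scalerA invrN mulNr mulVf ?scaleN1r// lt_eqF.
    have := @p_scale (- t)^-1 (u + t *: v0).
    rewrite invr_gt0 -kE => /(_ k0 (Ev _ _ Eu)) h2.
    have {}h : (- t)^-1 * r - (- t)^-1 * p (u + t *: v0) <= sup S.
      by apply: le_trans h; rewrite lerB.
    have := ler_wpM2l (ltW k0) h; rewrite -mulrBr mulVKf ?lt0r_neq0//; lra.
  + have h : sup S <= p (t^-1 *: u + v0) - t^-1 * r.
      by apply: ge_sup; [exact: hsS.1|exact: Sub].
    have kE : t^-1 *: u + v0 = t^-1 *: (u + t *: v0).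
      by rewrite scalerDr scalerA mulVf ?scale1r// lt0r_neq0.
    have := @p_scale t^-1 (u + t *: v0).
    rewrite invr_gt0 -kE => /(_ t0 (Ev _ _ Eu)) h2.
    have {}h : sup S <= t^-1 * p (u + t *: v0) - t^-1 * r.
      by apply: le_trans h _; rewrite lerB.
    have := ler_wpM2l (ltW t0) h; rewrite -mulrBr mulVKf ?lt0r_neq0//; lra.
Qed.

(** The difference of two values over [u] is a value over 0, and a large multiple of it would exceed
    [p 0]. *)
Lemma dominated_graph_fun (G : set (V * R)) u r s : dominated_graph G ->
  G (u, r) -> G (u, s) -> r = s.
Proof.
move=> [_ Glin Gp].
suff le_rs r' s' : G (u, r') -> G (u, s') -> r' <= s'.
  by move=> Gr Gs; apply/eqP; rewrite eq_le !le_rs.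
move=> Gr Gs; have [//|sr] := leP r' s'.
have := Glin (-1) _ _ _ _ Gs Gr; rewrite scaleN1r addNr mulN1r addrC => G1.
pose t := (`|p 0| + 1) / (r' - s').
have d0 : 0 < r' - s' by rewrite subr_gt0.
have := Glin t _ _ _ _ G1 G1; rewrite scaler0 addr0 => /Gp[_].
rewrite /t divfK ?lt0r_neq0//; have := ler_norm (p 0); lra.
Qed.

Theorem hahn_banach (G0 : set (V * R)) : dominated_graph G0 ->
  exists L : V -> R,
    [/\ forall t u v, E u -> E v -> L (t *: u + v) = t * L u + L v,
        forall u, E u -> L u <= p u
      & forall u r, G0 (u, r) -> L u = r].
Proof.
move=> G0d.
have [G [Gd Gmax]] := Zorn_bigcup (@dominated_graph_bigcup _ ^~ G0d).
set H := G `|` G0 in Gd.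
have [H0 Hlin Hp] := Gd.
have Htot u : E u -> exists r, H (u, r).
  move=> Eu; have [c Ud] := dominated_graph_extend Gd Eu.
  set U := [set e | _] in Ud.
  have HU : H `<=` U.
    by move=> [v r] Hv; exists v, r, 0; rewrite scale0r mul0r !addr0.
  have Uu : U (u, c) by exists 0, 0, 1; rewrite scale1r mul1r !add0r.
  have UG0 : U `|` G0 = U by apply/setUidl => x Gx; apply: HU; right.
  have [UG|UG] := pselect (U `<=` G); first by exists c; left; exact: UG.
  exfalso; apply: (Gmax U); last by rewrite /= UG0.
  by split => // x Gx; apply: HU; left.
(* Outside [E] the graph has no point and [L] takes the default 0. *)
pose L u := xget 0 [set r | H (u, r)].
have LH u : E u -> H (u, L u) by move=> /Htot; exact: (xgetPex 0).
have LE u r : H (u, r) -> L u = r.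
  move=> Hr; have [Eu _] := Hp _ _ Hr.
  exact: (dominated_graph_fun Gd (LH _ Eu) Hr).
exists L; split.
- by move=> t u v Eu Ev; apply: LE; apply: Hlin; exact: LH.
- by move=> u Eu; have [] := Hp _ _ (LH _ Eu).
- by move=> u r Gr; apply: LE; right.
Qed.

End hahn_banach.

(** * Souslin spaces *)

Section lindelof.

Definition countably_based (T : topologicalType) := exists C : set (set T),
  countable C /\ forall x V, nbhs x V -> exists U, [/\ C U, U x & U `<=` V].

(** A subcover is listed by a sequence of points of [S], which requires [S] to be nonempty; hence
    the first alternative. *)
Definition hereditarily_lindelof (T : topologicalType) :=
  forall (S : set T) (W : T -> set T), (forall x, S x -> nbhs x (W x)) ->
  S = set0 \/ exists g : nat -> T, (forall n, S (g n)) /\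
                                   S `<=` \bigcup_n W (g n).

Lemma separable_countably_based (R : realType) (P : pseudoMetricType R)
  (D : set P) : countable D -> dense D -> countably_based P.
Proof.
move=> cD dD; exists [set ball z.1 z.2.+1%:R^-1 | z in D `*` [set: nat]]; split.
  by apply: (sub_countable (card_image_le _ _)); exact: countableX.
move=> x V /nbhs_ballP[e /= e0 xV].
have e20 : 0 < e / 2 by rewrite divr_gt0.
have [n _ /(_ n (leqnn n)) /= ne] := near_infty_natSinv_lt (PosNum e20).
have n0 : 0 < n.+1%:R^-1 :> R by rewrite invr_gt0.
have [d []] : (ball x n.+1%:R^-1)° `&` D !=set0.
  apply: dD; last exact: open_interior.
  by exists x; apply: nbhsx_ballx.
move=> /interior_subset xd Dd; exists (ball d n.+1%:R^-1); split.
- by exists (d, n).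
- exact: ball_sym.
- move=> y dy; apply: xV; rewrite [e]splitr.
  by apply: (ball_triangle (le_ball (ltW ne) xd)); exact: (le_ball (ltW ne)).
Qed.

Lemma countably_based_prod (T1 T2 : topologicalType) :
  countably_based T1 -> countably_based T2 -> countably_based (T1 * T2)%type.
Proof.
move=> [C1 [cC1 B1]] [C2 [cC2 B2]].
exists [set z.1 `*` z.2 | z in C1 `*` C2]; split.
  by apply: (sub_countable (card_image_le _ _)); exact: countableX.
move=> [x1 x2] V [[V1 V2] /= [/B1[U1 [CU1 Ux1 UV1]] /B2[U2 [CU2 Ux2 UV2]]] V12].
exists (U1 `*` U2); split => //; first by exists (U1, U2).
by move=> [y1 y2] [/= /UV1 ? /UV2 ?]; exact: V12.
Qed.

(** For each basic set [U] one point [p] is selected, if there is any, with [f p] in [S] and [U]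
    inside the preimage of [W (f p)]; these countably many points suffice. Unlike a countable base,
    this covering property passes to continuous images. *)
Lemma countably_based_image_lindelof (P T : topologicalType) (f : P -> T) :
  countably_based P -> continuous f -> range f = setT ->
  hereditarily_lindelof T.
Proof.
move=> [C [cC CB]] cf fT S W SW.
have [->|/set0P[x0 Sx0]] := eqVneq S set0; [by left|right].
pose ok (U : set P) p := S (f p) /\ U `<=` f @^-1` (W (f p)).
have [p0 _ fp0] : range f x0 by rewrite fT.
(* The default [p0] lies over a point of [S] too, so every selected point does. *)
pose sel U := if pselect (exists p, ok U p) is left h then sval (cid h) else p0.
have Ssel U : S (f (sel U)).
  by rewrite /sel; case: pselect => [h|_]; [case: cid => p []|rewrite fp0].
have [C0|/set0P C0] := eqVneq C set0.
  by have [U []] := CB p0 setT filterT; rewrite C0.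
have /pfcard_geP[Ce|[g]] := cC.
  by case: C0 => U; rewrite Ce.
exists (fun n => f (sel (g n))); split => // x Sx.
have [p _ fpx] : range f x by rewrite fT.
have : nbhs p (f @^-1` (W (f p))) by apply: cf; apply: SW; rewrite fpx.
move=> /CB[U [CU Up UW]].
have [n _ gU] : (g @` setT) U by rewrite image_eq.
exists n => //; rewrite gU /sel; case: pselect => [h|[]]; last first.
  by exists p; split; rewrite ?fpx// -fpx.
by case: cid => q [_ /(_ p Up)] /=; rewrite fpx.
Qed.

End lindelof.

Section souslin_lindelof.
Context (R : realType).

Lemma souslin_lindelof (Z : topologicalType) :
  souslin R Z -> hereditarily_lindelof Z.
Proof.
move=> [_ [P [f [_ [D cD dD] cf fT]]]].
exact: countably_based_image_lindelof (separable_countably_based cD dD) cf fT.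
Qed.

(** This is needed for the complement of the diagonal of [Y * Y] and for the open subsets of
    [X * Y]. *)
Lemma souslin_prod_lindelof (Z1 Z2 : topologicalType) :
  souslin R Z1 -> souslin R Z2 -> hereditarily_lindelof (Z1 * Z2)%type.
Proof.
move=> [_ [P1 [f1 [_ [D1 cD1 dD1] cf1 fT1]]]] [_ [P2 [f2 [_ [D2 cD2 dD2] cf2 fT2]]]].
apply: (@countably_based_image_lindelof (P1 * P2)%type _ (fun z => (f1 z.1, f2 z.2))).
- by apply: countably_based_prod;
    [exact: (separable_countably_based cD1)|exact: (separable_countably_based cD2)].
- move=> z; apply: cvg_pair => /=.
    by apply: continuous_comp; [exact: cvg_fst|exact: cf1].
  by apply: continuous_comp; [exact: cvg_snd|exact: cf2].
- apply/seteqP; split => // -[x y] _.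
  have [p _ <-] : range f1 x by rewrite fT1.
  have [q _ <-] : range f2 y by rewrite fT2.
  by exists (p, q).
Qed.

End souslin_lindelof.

Lemma hausdorff_sep (T : topologicalType) (x y : T) : hausdorff_space T ->
  x <> y -> exists A B, [/\ open A, open B, A x, B y & A `&` B = set0].
Proof.
rewrite open_hausdorff => hT /eqP /hT[[A B] /= [/set_mem Ax /set_mem By]].
by move=> [oA oB /eqP AB]; exists A, B.
Qed.

(** An open set is a union of open rectangles, and the covering property leaves countably many of
    them. This reconciles the Borel sets of the product topology with the product sigma-algebra. *)
Lemma lindelof_prod_open_measurable (X Y : ptopologicalType)
    (O : set (borel X * borel Y)) :
  hereditarily_lindelof (X * Y)%type -> open (O : set (X * Y)) -> measurable O.
Proof.
move=> lXY oO.
have rect z : exists AB : set X * set Y, O z ->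
    [/\ open AB.1, open AB.2, (AB.1 `*` AB.2) z & AB.1 `*` AB.2 `<=` O].
  have [Oz|Oz] := pselect (O z); last by exists (set0, set0).
  have : nbhs (z : X * Y) O by exact: open_nbhs_nbhs.
  move=> [[A B] /= [Az Bz] ABO]; exists (A°, B°) => _ /=.
  split; [exact: open_interior|exact: open_interior|by []|].
  by move=> [x y] [/= /interior_subset ? /interior_subset ?]; exact: ABO.
have [W HW] := choice rect.
have [z Oz| |[g [gO Og]]] := @lXY O (fun z => (W z).1 `*` (W z).2).
- have [p1 p2 [w1 w2] _] := HW z Oz.
  by exists ((W z).1, (W z).2) => //; split; apply: open_nbhs_nbhs.
- by move=> ->; exact: measurable0.
have -> : O = \bigcup_n ((W (g n)).1 `*` (W (g n)).2).
  by apply/seteqP; split=> // z [n _ h]; have [_ _ _] := HW _ (gO n); apply.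
apply: bigcupT_measurable => n; have [p1 p2 _ _] := HW _ (gO n).
by apply: measurableX; exact: sub_sigma_algebra.
Qed.

Lemma antitone_setS (T : Type) (C : nat -> set T) m n :
  (forall k, C k.+1 `<=` C k) -> (m <= n)%N -> C n `<=` C m.
Proof.
move=> niC /subnK <-; elim: (n - m)%N => [//|k IH].
by rewrite addSn => x /niC /IH.
Qed.

(** * Tightness of Borel probability measures on Souslin spaces *)

Section tightness.
Context (R : realType) (P : completePseudoMetricType R).

Lemma ultra_bigcup_ord (T : Type) (G : set_system T) (Z : nat -> set T) n :
  UltraFilter G -> G (\bigcup_(i < n) Z i) -> exists i, G (Z i).
Proof.
move=> GU; elim: n => [|n IH]; first by rewrite bigcup_mkord big_ord0 => /filter_not_empty.
move=> Gn; have [|Gc] := in_ultra_setVsetC (Z n) GU; first by exists n.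
apply: IH; apply: filterS (filterI Gn Gc) => x [[i /= + Zi] Zn].
rewrite ltnS leq_eqVlt => /orP[/eqP ie|il]; last by exists i.
by move: Zn; rewrite /= -ie.
Qed.

Context (Z : nat -> nat -> set P) (C : nat -> set P) (N : nat -> nat).
Hypothesis C_closed : forall k, closed (C k).
Hypothesis C_nonincr : forall k, C k.+1 `<=` C k.
Hypothesis C_cover : forall j, C j.+1 `<=` \bigcup_(i < N j) Z j i.
Hypothesis Z_small : forall j i, exists x, Z j i `<=` ball x j.+1%:R^-1.

(** An ultrafilter containing [C j.+1] contains one of the finitely many [Z j i] that cover it,
    hence a ball of radius [1 / (j + 1)]; so it is Cauchy, and completeness gives the limit. *)
Lemma totally_bounded_ultra_cvg (G : set_system P) : UltraFilter G ->
  (forall k, G (C k)) -> exists p, (\bigcap_k C k) p /\ G --> p.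
Proof.
move=> GU GC.
have : cauchy G.
  apply: cauchy_exP => e e0.
  have [j _ /(_ j (leqnn j)) /= je] := near_infty_natSinv_lt (PosNum e0).
  have [i Gi] := ultra_bigcup_ord GU (filterS (@C_cover j) (GC j.+1)).
  have [x Zx] := Z_small j i; exists x; apply: filterS Gi => y /Zx.
  by apply: le_ball; exact: ltW.
move=> /cauchy_cvg /cvg_ex[p Gp]; exists p; split => // k _.
have : cluster G p by rewrite ultra_cvg_clusterE.
by rewrite clusterE => /(_ _ (GC k)); rewrite -(closure_id _).1.
Qed.

Lemma totally_bounded_compact : compact (\bigcap_k C k).
Proof.
rewrite compact_ultra => G GU GK.
have [|p [Kp Gp]] := totally_bounded_ultra_cvg GU; last by exists p.
by move=> k; apply: filterS GK; exact: bigcap_inf.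
Qed.

(** The single sets [C k] need not be compact. If none were contained in [V], the differences of
    [C k] and [V] would generate a filter, and a finer ultrafilter would converge to a point of the
    intersection, which lies in the open set [V]. *)
Lemma totally_bounded_sub_open (V : set P) : open V -> \bigcap_k C k `<=` V ->
  exists k, C k `<=` V.
Proof.
move=> oV KV; apply: contrapT => /forallNP noV.
pose F := filter_from [set: nat] (fun k => C k `\` V).
have FF : ProperFilter F.
  apply: filter_from_proper.
    apply: filter_from_filter; first by exists 0%N.
    move=> i j _ _; exists (maxn i j) => // x [Cx nVx].
    by split; split => //; apply: (antitone_setS C_nonincr _ Cx);
      rewrite ?leq_maxl ?leq_maxr.
  by move=> k _; apply: contrapT => /nonemptyPn; rewrite setD_eq0; exact: noV.
have [G [GU FG]] := ultraFilterLemma FF.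
have GD k : G (C k `\` V) by apply: FG; exists k.
have [k|p [Kp Gp]] := totally_bounded_ultra_cvg GU.
  by apply: filterS (GD k) => x [].
have : G V by apply: Gp; apply: open_nbhs_nbhs; split => //; exact: KV.
by move=> /(filterI (GD 0%N)) /filter_ex[x [[_ ]]].
Qed.

End tightness.

Lemma measurable_fun_generated d (T : measurableType d) (Y : pointedType)
    (G : set (set Y)) (f : T -> g_sigma_algebraType G) :
  (forall U, G U -> measurable (f @^-1` U)) -> measurable_fun setT f.
Proof.
move=> fU; apply: (@measurability _ _ T (g_sigma_algebraType G) setT f G erefl).
by move=> _ [U GU <-]; rewrite setTI; exact: fU.
Qed.

Section souslin_tight.
Context (R : realType) (Y : ptopologicalType) (nu : probability (borel Y) R).

Lemma open_measurable_borel (U : set Y) : open U -> measurable (U : set (borel Y)).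
Proof. exact: sub_sigma_algebra. Qed.

Lemma closed_measurable_borel (U : set Y) :
  closed U -> measurable (U : set (borel Y)).
Proof.
by move=> cU; rewrite -[U]setCK; apply: measurableC; apply: open_measurable_borel;
  exact: closed_openC.
Qed.

(* [c < nu^* A] for the outer measure [nu^*] *)
Definition outer_gt (c : \bar R) (A : set Y) :=
  forall B : set (borel Y), measurable B -> A `<=` B -> (c < nu B)%E.

(** The images to be measured need not be Borel, hence the outer measure. If no [n] works, each
    [A n] has a measurable hull [B n] of measure at most [c]; the intersections [B' n] of the later
    hulls still contain [A n] and increase, so continuity from below applies to them. *)
Lemma outer_gt_nondecreasing (c : \bar R) (A : nat -> set Y) :
  nondecreasing_seq A -> outer_gt c (\bigcup_n A n) -> exists n, outer_gt c (A n).
Proof.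
move=> ndA cA; apply: contrapT => /forallNP noA.
have /choice[B HB] n : exists B : set (borel Y),
    [/\ measurable B, A n `<=` B & (nu B <= c)%E].
  have := noA n; move=> /existsNP[B /not_implyP[mB /not_implyP[AB /negP]]].
  by rewrite -leNgt => Bc; exists B.
pose B' n := \bigcap_(m in [set m | (n <= m)%N]) B m.
have mB' n : measurable (B' n).
  by apply: bigcap_measurable => [|m _]; [exists n => /=|have [] := HB m].
have B'c n : (nu (B' n) <= c)%E.
  have [mB _ Bc] := HB n; apply: le_trans Bc; apply: le_measure; rewrite ?inE//.
  by apply: bigcap_inf => /=.
have ndB' : nondecreasing_seq B'.
  move=> m n mn; apply/subsetPset => x B'x k /= nk; apply: B'x => /=.
  exact: leq_trans nk.
have mU : measurable (\bigcup_n B' n) by exact: bigcupT_measurable.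
have : (c < nu (\bigcup_n B' n))%E.
  apply: cA => // x [n _ Anx]; exists n => // m /= nm; have [_ + _] := HB m.
  by apply; have /subsetPset := ndA _ _ nm; apply.
have Bcvg := nondecreasing_cvg_mu (mu := nu) mB' mU ndB'.
rewrite ltNge => /negP; apply.
by rewrite -(cvg_lim _ Bcvg)//; apply: lime_le; [apply/cvg_ex; eexists; exact: Bcvg|
  exact: nearW].
Qed.

(** [K] is a countable intersection of open sets: each point outside [K] has an open neighbourhood
    disjoint from an open set containing [K], and countably many of these neighbourhoods cover the
    complement. Continuity from above then gives the bound. *)
Lemma compact_le_outer (c : \bar R) (K : set Y) : hereditarily_lindelof Y ->
  hausdorff_space Y -> compact K ->
  (forall U, open U -> K `<=` U -> (c <= nu U)%E) -> (c <= nu K)%E.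
Proof.
move=> lY hY cK cU.
have /choice[W HW] y : exists VU : set Y * set Y, ~ K y ->
    [/\ open VU.1, open VU.2, VU.1 y, K `<=` VU.2 & VU.1 `&` VU.2 = set0].
  have [Ky|nKy] := pselect (K y); first by exists (set0, set0).
  (* Every [k] in [K] has a neighbourhood missed by the closures of all small enough neighbourhoods
     of [y]; compactness makes the smallness uniform and yields one neighbourhood of [y] whose
     closure misses [K]. *)
  have /compact_near_coveringP := cK.
  move=> /(_ (set Y) (powerset_filter_from (nbhs y)) (fun V k => ~ closure V k)).
  case.
    move=> k Kk; have yk : y <> k by move=> yk; rewrite yk in nKy.
    have [A [B [oA oB Ay Bk AB]]] := hausdorff_sep hY yk.
    exists (B, [set V | nbhs y V /\ V `<=` A]).
      split; first by apply: open_nbhs_nbhs.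
      by apply: powerset_filter_fromP; apply: open_nbhs_nbhs.
    move=> [k' V] [/= Bk' [_ VA]] /(_ B); rewrite /= => /(_ (open_nbhs_nbhs (conj oB Bk'))).
    by move=> [z [/VA Az Bz]]; have : (A `&` B) z by []; rewrite AB.
  move=> F [FN _ [V FV]] /(_ V FV) /= KV; have Vy := FN V FV.
  exists (V°, ~` closure V) => _; split => //=.
  - exact: open_interior.
  - by apply: closed_openC; exact: closed_closure.
  - apply/disjoints_subset; rewrite setCK.
    by move=> z /interior_subset; exact: subset_closure.
have mK : measurable (K : set (borel Y)).
  by apply: closed_measurable_borel; exact: compact_closed.
have [y nKy| |[g [gK Kg]]] := lY (~` K) (fun y => (W y).1).
- by have [p1 _ p3 _ _] := HW y nKy; exact: open_nbhs_nbhs.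
- move=> K0; have -> : K = setT by rewrite -[K]setCK K0 setC0.
  by apply: cU => //; exact: openT.
pose U n := \bigcap_(i < n) (W (g i)).2.
have oU n : open (U n).
  rewrite -[U n]setCK; apply: closed_openC; rewrite setC_bigcap bigcup_mkord.
  apply: closed_bigsetU => i _; apply: open_closedC.
  by have [] := HW _ (gK i).
have mU n : measurable (U n : set (borel Y)) by exact: open_measurable_borel.
have KE : K = \bigcap_n U n.
  apply/seteqP; split => [x Kx n _ i _|x Ux].
    by have [_ _ _ KU _] := HW _ (gK i); exact: KU.
  apply: contrapT => /Kg[n _ Wx]; have [_ _ _ _ W0] := HW _ (gK n).
  have : ((W (g n)).1 `&` (W (g n)).2) x by split => //; apply: (Ux n.+1) => /=.
  by rewrite W0.
have Ucvg : nu \o U @ \oo --> nu K.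
  rewrite KE; apply: nonincreasing_cvg_mu => //; last 2 first.
  - by rewrite -KE.
  - move=> m n mn; apply/subsetPset => x Ux i /= im; apply: Ux => /=.
    exact: leq_trans mn.
  - by rewrite ltey_eq fin_num_measure.
rewrite -(cvg_lim _ Ucvg)//; apply: lime_ge; first by apply/cvg_ex; eexists; exact: Ucvg.
by apply: nearW => n; apply: cU => //; rewrite KE; exact: bigcap_inf.
Qed.

(** Choquet's capacitability argument: at each stage finitely many small closed balls are kept,
    enough for the outer measure of the image to stay above [c]. The sets [C k] shrink to a compact
    set, and an open set containing its image contains the image of some [C k], hence has measure
    above [c]. *)
Lemma souslin_tight (c : \bar R) : souslin R Y -> (c < 1)%E ->
  exists K : set Y, compact K /\ (c <= nu K)%E.
Proof.
move=> sY c1; have lY := souslin_lindelof sY.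
have [hY [P [f [hP [D cD dD] cf fT]]]] := sY.
have [p0 _ _] : range f point by rewrite fT.
have [d [_ Dd]] : setT `&` D !=set0 by apply: dD; [exists p0|exact: openT].
have /pfcard_geP[D0|[p]] := cD; first by rewrite D0 in Dd.
pose Z j i := closure (ball (p i) (j.+1%:R^-1 / 2)).
pose U k n := \bigcup_(i < n) Z k i.
(* For [A = C k] an admissible [n] exists, because the sets [U k n] increase to the whole space and
   the outer measure is continuous from below. *)
pose pick k A := xget 0%N [set n | outer_gt c (f @` (A `&` U k n))].
pose C := fix C k := if k is k'.+1 then C k' `&` U k' (pick k' (C k')) else setT.
have r0 j : 0 < j.+1%:R^-1 :> R by rewrite invr_gt0.
have UT k : \bigcup_n U k n = setT.
  apply/seteqP; split => // x _.
  have [y [/interior_subset xy Dy]] : (ball x (k.+1%:R^-1 / 2))° `&` D !=set0.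
    apply: dD; last exact: open_interior.
    by exists x; apply: nbhsx_ballx; rewrite divr_gt0.
  have [i _ piy] : (p @` setT) y by rewrite image_eq.
  by exists i.+1 => //; exists i => //=; apply: subset_closure; rewrite piy; exact: ball_sym.
have Cgt k : outer_gt c (f @` C k).
  elim: k => [|k IH].
    move=> B mB; rewrite /= fT => TB; suff -> : B = setT by rewrite probability_setT.
    by apply/seteqP; split.
  apply: (@xgetPex _ 0%N [set n | outer_gt c (f @` (C k `&` U k n))]).
  apply: outer_gt_nondecreasing.
    move=> m n mn; apply/subsetPset; apply: image_subset; apply: setIS.
    by move=> x [i /= im Zi]; exists i => //=; exact: leq_trans mn.
  rewrite -image_bigcup -setI_bigcupr UT setIT; exact: IH.
have CC k : closed (C k).
  elim: k => [|k IH] /=; first exact: closedT.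
  apply: closedI => //; rewrite /U bigcup_mkord; apply: closed_bigsetU => i _.
  exact: closed_closure.
have Cni k : C k.+1 `<=` C k by move=> x [].
have Ccov j : C j.+1 `<=` \bigcup_(i < pick j (C j)) Z j i by move=> x [].
have Zs j i : exists x, Z j i `<=` ball x j.+1%:R^-1.
  by exists (p i); exact: subset_closure_half.
have cK := totally_bounded_compact CC Ccov Zs.
exists (f @` \bigcap_k C k); split.
  by apply: continuous_compact => //; exact: continuous_subspaceT.
apply: compact_le_outer => //.
  by apply: continuous_compact => //; exact: continuous_subspaceT.
move=> V oV KV.
have [||k CV] := totally_bounded_sub_open CC Cni Ccov Zs (V := f @^-1` V).
- by apply: open_comp => // x _; exact: cf.
- by move=> x Kx; apply: KV; exists x.
apply: ltW; apply: (Cgt k); first exact: open_measurable_borel.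
by move=> _ [x /CV Vx <-].
Qed.

Lemma souslin_sigma_compact : souslin R Y ->
  exists K : nat -> set Y, (forall n, compact (K n)) /\ nu (\bigcup_n K n) = 1%E.
Proof.
move=> sY.
have /choice[K HK] n : exists K : set Y,
    compact K /\ ((1 - n.+1%:R^-1)%:E <= nu K)%E.
  by apply: souslin_tight => //; rewrite lte_fin ltrBlDr ltrDl invr_gt0.
have mK n : measurable (K n : set (borel Y)).
  by apply: closed_measurable_borel; apply: compact_closed; [case: sY|case: (HK n)].
exists K; split; first by move=> n; have [] := HK n.
have mUK : measurable (\bigcup_n K n : set (borel Y)) by exact: bigcupT_measurable.
apply/eqP; rewrite eq_le probability_le1//=.
apply/lee_subgt0Pr => e e0.
have [n _ /(_ n (leqnn n)) /= ne] := near_infty_natSinv_lt (PosNum e0).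
apply: (@le_trans _ _ ((1 - n.+1%:R^-1)%:E)).
  by rewrite -EFinB lee_fin lerB// ltW.
have [_ /le_trans] := HK n; apply; apply: le_measure; rewrite ?inE//.
exact: bigcup_sup.
Qed.

End souslin_tight.

(** * Coding of binary sequences by points of the Cantor set *)

Section ternary_code.
Context (R : realType).
Implicit Types (c : nat -> bool) (r : R).

(** Base 3 with the digits 0 and 2: the two choices of the first digit leave a gap between 1/3 and
    2/3, so digits can be read off from the number, which fails for binary expansions. *)
Definition ternary_sum c n : R := \sum_(i < n) (2 * (c i)%:R / 3 ^+ i.+1).
Definition ternary c : R := limn (ternary_sum c).
(** On the Cantor set this is the shift of the digits. *)
Definition ternary_step r : R := 3 * r - 2 * ((2 / 3 <= r)%R : bool)%:R.
Definition ternary_bit r n : bool := 2 / 3 <= iter n ternary_step r.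

Lemma ternary_sumS c n :
  ternary_sum c n.+1 = (2 * (c 0%N)%:R + ternary_sum (c \o S) n) / 3.
Proof.
rewrite /ternary_sum big_ord_recl expr1 [RHS]mulrDl mulr_suml; congr (_ + _).
by apply: eq_bigr => i _ /=; rewrite [in LHS]exprS invfM; ring.
Qed.

Lemma ternary_sum_le1 c n : ternary_sum c n <= 1.
Proof.
elim: n c => [|n IH] c; first by rewrite /ternary_sum big_ord0.
by rewrite ternary_sumS; have := IH (c \o S); case: (c 0%N) => /=; lra.
Qed.

Lemma ternary_sum_nd c : nondecreasing_seq (ternary_sum c).
Proof.
apply/nondecreasing_seqP => n; rewrite /ternary_sum big_ord_recr lerDl/=.
by rewrite divr_ge0// ?exprn_ge0// mulr_ge0.
Qed.

Lemma ternary_cvg c : ternary_sum c @ \oo --> ternary c.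
Proof.
apply: nondecreasing_is_cvgn; first exact: ternary_sum_nd.
by exists 1 => _ [n _ <-]; exact: ternary_sum_le1.
Qed.

Lemma ternary_ge0 c : 0 <= ternary c.
Proof.
apply: limr_ge; first exact: ternary_cvg.
apply: nearW => n; apply: sumr_ge0 => i _.
by rewrite divr_ge0// ?exprn_ge0// mulr_ge0.
Qed.

Lemma ternary_le1 c : ternary c <= 1.
Proof.
apply: limr_le; first exact: ternary_cvg.
by apply: nearW => n; exact: ternary_sum_le1.
Qed.

Lemma ternaryE c : ternary c = (2 * (c 0%N)%:R + ternary (c \o S)) / 3.
Proof.
have h1 : (fun n => ternary_sum c n.+1) @ \oo --> ternary c.
  by have := @ternary_cvg c; rewrite -cvg_shiftS.
have h2 : (fun n => ternary_sum c n.+1) @ \oo -->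
    (2 * (c 0%N)%:R + ternary (c \o S)) / 3.
  under eq_fun do rewrite ternary_sumS.
  by apply: cvgMl; apply: cvgD; [exact: cvg_cst|exact: ternary_cvg].
exact: (cvg_unique _ h1 h2).
Qed.

Lemma ternary_bit0 c : (2 / 3 <= ternary c) = c 0%N.
Proof.
rewrite ternaryE; have := ternary_ge0 (c \o S); have := ternary_le1 (c \o S).
by case: (c 0%N) => /= ? ?; [apply/idP|apply/negP]; lra.
Qed.

Lemma ternary_stepE c : ternary_step (ternary c) = ternary (c \o S).
Proof. by rewrite /ternary_step ternary_bit0 [X in 3 * X]ternaryE; field. Qed.

Lemma ternary_bitK c n : ternary_bit (ternary c) n = c n.
Proof.
rewrite /ternary_bit.
suff -> : iter n ternary_step (ternary c) = ternary (fun i => c (n + i)%N).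
  by rewrite ternary_bit0 addn0.
elim: n => [|n IH] //=; rewrite IH ternary_stepE; congr ternary.
by apply/funext => i /=; rewrite addSnnS.
Qed.

Lemma measurable_ternary_bit n : measurable [set r | ternary_bit r n].
Proof.
have mstep : measurable_fun setT ternary_step.
  apply: measurable_funB; first exact: measurable_funM.
  apply: measurable_funM => //.
  rewrite (_ : (fun r => _) = \1_(`[2 / 3, +oo[%classic)); last first.
    by apply/funext => r; rewrite indicE mem_setE in_itv/= andbT.
  exact: measurable_indic.
have mi : measurable_fun setT (iter n ternary_step).
  elim: n => [|n IH] /=; first exact: measurable_id.
  exact: measurableT_comp.
rewrite (_ : [set r | _] = iter n ternary_step @^-1` `[2 / 3, +oo[%classic).
  by rewrite -[X in measurable X]setTI; exact: mi.
by apply/seteqP; split => r /=; rewrite /ternary_bit in_itv/= andbT.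
Qed.

(** [P] is an arbitrary predicate: only finitely many prefixes occur, and the induction splits on
    the last bit, which [upd] freezes. *)
Lemma measurable_ternary_bits n (P : (nat -> bool) -> Prop) :
  (forall c c', (forall i, (i < n)%N -> c i = c' i) -> P c -> P c') ->
  measurable [set r | P (ternary_bit r)].
Proof.
elim: n P => [|n IH] P HP.
  have [Pc|Pc] := pselect (P (fun _ => false)).
    rewrite (_ : [set _ | _] = setT); first exact: measurableT.
    by apply/seteqP; split => // r _ /=; exact: HP Pc.
  rewrite (_ : [set _ | _] = set0); first exact: measurable0.
  by apply/seteqP; split => // r /= Pr; apply: Pc; exact: HP Pr.
pose upd (b : bool) c i := if i == n then b else c i.
have Hupd b c c' : (forall i, (i < n)%N -> c i = c' i) ->
    P (upd b c) -> P (upd b c').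
  move=> cc'; apply: HP => i; rewrite ltnS leq_eqVlt /upd.
  by case: eqP => //= _; exact: cc'.
have updE c : upd (c n) c = c.
  by apply/funext => i; rewrite /upd; case: eqP => // ->.
rewrite (_ : [set r | _] =
    ([set r | ternary_bit r n] `&` [set r | P (upd true (ternary_bit r))]) `|`
    (~` [set r | ternary_bit r n] `&` [set r | P (upd false (ternary_bit r))])).
  apply: measurableU; apply: measurableI.
  - exact: measurable_ternary_bit.
  - exact: (IH (fun c => P (upd true c)) (Hupd true)).
  - by apply: measurableC; exact: measurable_ternary_bit.
  - exact: (IH (fun c => P (upd false c)) (Hupd false)).
apply/seteqP; split => r /=; have := updE (ternary_bit r).
  by case: (ternary_bit r n) => -> Pr; [left|right].
by case: (ternary_bit r n) => e -[[+]|[+]]; rewrite ?e.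
Qed.

End ternary_code.
Arguments ternary_sum {R} c n.
Arguments ternary {R} c.

Lemma compact_bigcap_nonempty (T : topologicalType) (C : nat -> set T) :
  compact (C 0%N) -> (forall n, closed (C n)) -> (forall n, C n.+1 `<=` C n) ->
  (forall n, C n !=set0) -> \bigcap_n C n !=set0.
Proof.
move=> cC0 clC niC nC.
pose F := filter_from [set: nat] C.
have FF : ProperFilter F.
  apply: filter_from_proper; last by move=> k _; exact: nC.
  apply: filter_from_filter; first by exists 0%N.
  by move=> i j _ _; exists (maxn i j) => // x Cx; split;
    apply: (antitone_setS niC _ Cx); rewrite ?leq_maxl ?leq_maxr.
have [p [_ Fp]] := cC0 F FF (ex_intro2 _ _ 0%N I (fun x => id)).
exists p => n _; rewrite (closure_id (C n)).1//.
by move: Fp; rewrite clusterE; apply; exists n.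
Qed.

(** * Coding of the points of a Souslin space by numbers *)

Section souslin_code.
Context (R : realType) (Y : ptopologicalType) (nu : probability (borel Y) R).

(* [E n] and [G n] are closed sets covering [Y] such that any two points are
   separated by some pair; choosing one of them for each [n] leaves at most one
   point, and by compactness the choices that leave a point of a closed subset
   of [K m] form a Borel set of codes. *)
Lemma souslin_code : souslin R Y ->
  exists (s : borel Y -> R) (q : R -> borel Y) (D : set (borel Y)),
    [/\ measurable_fun setT s, measurable_fun setT q,
        forall y, 0 <= s y <= 1,
        measurable D /\ nu D = 1%E & forall y, D y -> q (s y) = y].
Proof.
move=> sY; have [hY _] := sY.
have [A [B [oA oB AB0 sep]]] : exists A B : nat -> set Y,
    [/\ forall n, open (A n), forall n, open (B n), forall n, A n `&` B n = set0
      & forall x y, x <> y -> exists n, A n x /\ B n y].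
  have /choice[W HW] (z : Y * Y) : exists VU : set Y * set Y, z.1 <> z.2 ->
      [/\ open VU.1, open VU.2, VU.1 z.1, VU.2 z.2 & VU.1 `&` VU.2 = set0].
    have [ze|nze] := pselect (z.1 = z.2); first by exists (set0, set0).
    by have [V [U [*]]] := hausdorff_sep hY nze; exists (V, U).
  have := @souslin_prod_lindelof R _ _ sY sY [set z | z.1 <> z.2]
    (fun z => (W z).1 `*` (W z).2).
  case.
  - move=> z /HW[p1 p2 p3 p4 _].
    by exists ((W z).1, (W z).2) => //; split; apply: open_nbhs_nbhs.
  (* No two points are distinct here, so empty sets separate. *)
  - move=> h; exists (fun=> set0), (fun=> set0); split => //.
    + by move=> _; exact: open0.
    + by move=> _; exact: open0.
    + by move=> n; rewrite setI0.
    + by move=> x y xy; have : [set z : Y * Y | z.1 <> z.2] (x, y) by []; rewrite h.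
  - move=> [g [gS Sg]]; exists (fun n => (W (g n)).1), (fun n => (W (g n)).2).
    split=> [n|n|n|x y xy]; try by have [] := HW _ (gS n).
    by have [n _ [/= Wx Wy]] := Sg (x, y) xy; exists n.
have [K [cK nuK]] := souslin_sigma_compact nu sY.
(* [Z c n] is the closed set chosen at stage [n]; since [A n] and [B n] are disjoint, every point
   lies in the sets chosen by its own bits. *)
pose Z (c : nat -> bool) n := if c n then ~` B n else ~` A n.
have Zuniq c x y : (forall n, Z c n x) -> (forall n, Z c n y) -> x = y.
  move=> Zx Zy; apply: contrapT => /sep[n [Ax By]].
  by have := Zx n; have := Zy n; rewrite /Z; case: (c n).
have clZ c n : closed (Z c n).
  by rewrite /Z; case: (c n); exact: open_closedC.
have clK m : closed (K m) by exact: compact_closed.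
pose bits y n := y \in A n.
have Zbits y n : Z (bits y) n y.
  rewrite /Z /bits; case: ifPn => [/set_mem Ay By|/negP nA Ay]; last first.
    by apply: nA; rewrite inE.
  by have : (A n `&` B n) y by []; rewrite AB0.
pose pt (c : nat -> bool) := \bigcup_m K m `&` [set y | forall n, Z c n y].
pose s (y : borel Y) : R := ternary (bits y).
pose q (r : R) : borel Y := xget point (pt (ternary_bit r)).
exists s, q, (\bigcup_m K m); split.
- apply: (@measurable_fun_cvg _ (borel Y) R [set: borel Y] (fun n (y : borel Y) => ternary_sum (bits y) n) s).
    move=> n; apply: measurable_sum => i; apply: measurable_funM => //.
    apply: measurable_funM => //.
    rewrite (_ : (fun x => _) = \1_(A i)); last first.
      by apply/funext => y; rewrite indicE.
    by apply: measurable_indic; exact: open_measurable_borel.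
  by move=> y _; exact: ternary_cvg.
- have mM m (D : set Y) : closed D ->
      measurable [set r : R | exists y, [/\ K m y, D y & forall n, Z (ternary_bit r) n y]].
    move=> cD.
    pose C (r : R) n := K m `&` D `&` \bigcap_(i < n) Z (ternary_bit r) i.
    (* By compactness a code fits a point of [K m] in [D] as soon as each of its finite prefixes
       does, and a condition on a prefix is measurable. *)
    rewrite (_ : [set r | _] = \bigcap_n [set r | C r n !=set0]).
      apply: bigcapT_measurable => n.
      apply: (@measurable_ternary_bits R n
        (fun c => K m `&` D `&` \bigcap_(i < n) Z c i !=set0)).
      move=> c c' cc' [y [KDy Zy]]; exists y; split => // i /= ilt.
      by have := Zy i ilt; rewrite /Z cc'.
    apply/seteqP; split => r /=.
      by move=> [y [Ky Dy Zy]] n _; exists y; split.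
    move=> Cr; have [|n|n|n|y Hy] := @compact_bigcap_nonempty Y (C r).
    + rewrite /C bigcap_mkord big_ord0 setIT.
      by apply: compact_closedI.
    + apply: closedI; first exact: closedI.
      by apply: closed_bigI => i _; exact: clZ.
    + by move=> y [KDy Zy]; split => // i /= ilt; apply: Zy => /=; exact: ltnW.
    + exact: Cr.
    exists y; have [[Ky Dy] _] := Hy 0%N I; split => // n.
    by have [_ +] := Hy n.+1 I; apply => /=.
  suff H D : closed D -> measurable (q @^-1` D).
    apply: measurable_fun_generated => U oU.
    rewrite -[U]setCK preimage_setC; apply: measurableC; apply: (H (~` U)).
    exact: open_closedC.
  move=> cD.
  (* Codes that fit no point of any [K m] are decoded to [point]; the second set collects them when
     [point] lies in [D]. *)
  rewrite (_ : q @^-1` D =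
    (\bigcup_m [set r : R | exists y, [/\ K m y, D y & forall n, Z (ternary_bit r) n y]]) `|`
    (~` (\bigcup_m [set r : R | exists y, [/\ K m y, setT y & forall n, Z (ternary_bit r) n y]])
      `&` [set r | D point])).
    apply: measurableU; first by apply: bigcupT_measurable => m; exact: mM.
    apply: measurableI; last first.
      have [Dp|Dp] := pselect (D point).
        by rewrite (_ : [set _ | _] = setT)//; apply/seteqP; split.
      by rewrite (_ : [set _ | _] = set0)//; apply/seteqP; split.
    by apply: measurableC; apply: bigcupT_measurable => m; apply: mM; exact: closedT.
  apply/seteqP; split => r /=.
    rewrite /q; case: xgetP => [y _ [[m _ Km] Zy] Dy|npt Dp].
      by left; exists m => //; exists y.
    right; split => // -[m _ [y [Ky _ Zy]]].
    by apply: (npt y); split => //; exists m.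
  rewrite /q; case: xgetP => [y _ [[m _ Km] Zy]|npt].
    case=> [[m' _ [y' [Ky' Dy' Zy']]]|[nex Dp]].
      by rewrite (Zuniq _ _ _ Zy Zy').
    by exfalso; apply: nex; exists m => //; exists y.
  case=> [[m' _ [y' [Ky' Dy' Zy']]]|[]//].
  by exfalso; apply: (npt y'); split => //; exists m'.
- by move=> y; rewrite ternary_ge0 ternary_le1.
- split => //; apply: bigcupT_measurable => m; exact: closed_measurable_borel.
- move=> y [m _ Ky]; rewrite /q /s.
  have -> : ternary_bit (ternary (bits y) : R) = bits y.
    by apply/funext => n; rewrite ternary_bitK.
  case: xgetP => [y' _ [_ Zy']|npt]; first exact: (Zuniq _ _ _ Zy' (Zbits y)).
  by exfalso; apply: (npt y); split => //; exists m.
Qed.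

End souslin_code.

(** * Bimeasures and conditional distribution functions *)

Section dominated_measure.
Context d (T : measurableType d) (R : realType).
Context (nu : {finite_measure set T -> \bar R}).

(** Positivity and additivity are stated for all sets because [m] will come from a functional
    defined on indicators of arbitrary sets; only the bound speaks of measurable ones. *)
Definition dominated_additive (m : set T -> R) :=
  [/\ forall A, 0 <= m A,
      forall A B, A `&` B = set0 -> m (A `|` B) = m A + m B
    & forall A, measurable A -> ((m A)%:E <= nu A)%E].

(** The proof [H] is an argument so that the measure structure can be attached to this function. *)
Definition dominated_measure (m : set T -> R) (H : dominated_additive m) :
  set T -> \bar R := fun A => (m A)%:E.

Context (m : set T -> R) (H : dominated_additive m).

Lemma dominated_additive0 : m set0 = 0.
Proof.
have [_ add _] := H; have := add set0 set0 (setI0 _).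
by rewrite setU0; lra.
Qed.

Let m0 : dominated_measure H set0 = 0%E.
Proof. by rewrite /dominated_measure dominated_additive0. Qed.

Let m_ge0 A : (0 <= dominated_measure H A)%E.
Proof. by have [h _ _] := H; rewrite lee_fin. Qed.

Lemma dominated_additive_bigU (F : (set T)^nat) n : trivIset setT F ->
  m (\bigcup_(i < n) F i) = \sum_(i < n) m (F i).
Proof.
move=> tF; elim: n => [|n IH].
  by rewrite bigcup_mkord !big_ord0 dominated_additive0.
have [_ add _] := H.
rewrite big_ord_recr/= -IH -add; last first.
  apply/seteqP; split => // x [[i /= ilt Fi] Fn].
  have := tF i n I I (ex_intro _ x (conj Fi Fn)) => ein.
  by rewrite ein ltnn in ilt.
by congr m; rewrite !bigcup_mkord big_ord_recr.
Qed.

(** The tails [G n] of a disjoint union decrease to the empty set, so [nu (G n)], and with it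
    [m (G n)], tends to 0. *)
Let m_sigma_additive : semi_sigma_additive (dominated_measure H).
Proof.
move=> F mF tF mUF; have [ge0 add le] := H.
pose G n := \bigcup_(i in [set i | (n <= i)%N]) F i.
have mG n : measurable (G n).
  by apply: bigcup_measurable => k _; exact: mF.
have GE n : m (\bigcup_k F k) = \sum_(i < n) m (F i) + m (G n).
  rewrite -dominated_additive_bigU// -add.
    congr m; apply/seteqP; split => [x [i _ Fi]|x [[i _ Fi]|[i _ Fi]]]; last 2 first.
    - by exists i.
    - by exists i.
    by have [ilt|nle] := ltnP i n; [left; exists i|right; exists i].
  apply/seteqP; split => // x [[i /= ilt Fi] [j /= jge Fj]].
  have ij := tF i j I I (ex_intro _ x (conj Fi Fj)).
  by rewrite ij ltnNge jge in ilt.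
have G0 : \bigcap_n G n = set0.
  apply/seteqP; split => // x Gx; have [i _ Fi] := Gx 0%N I.
  have [j /= ij Fj] := Gx i.+1 I.
  by have e := tF i j I I (ex_intro _ x (conj Fi Fj)); rewrite e ltnn in ij.
have nuG : nu \o G @ \oo --> 0%E.
  rewrite -(measure0 nu) -G0; apply: nonincreasing_cvg_mu => //.
  - by rewrite ltey_eq fin_num_measure.
  - by rewrite G0.
  - move=> i j ij; apply/subsetPset => x [k /= jk Fk]; exists k => //=.
    exact: leq_trans jk.
have mG0 : (fun n => (m (G n))%:E) @ \oo --> 0%E.
  apply: (@squeeze_cvge _ _ _ _ (cst 0%E) _ (nu \o G)) => //; last exact: cvg_cst.
  by apply: nearW => n; rewrite lee_fin ge0/=; exact: le.
rewrite /dominated_measure.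
have : (fun n => (m (\bigcup_k F k))%:E - (m (G n))%:E)%E @ \oo -->
    ((m (\bigcup_k F k))%:E - 0)%E.
  by apply: cvgeB => //; exact: cvg_cst.
rewrite sube0; apply: cvg_trans; apply: near_eq_cvg; apply: nearW => n.
by rewrite -EFinB (GE n) addrK -sumEFin big_mkord.
Qed.

HB.instance Definition _ := isMeasure.Build _ _ _ (dominated_measure H)
  m0 m_ge0 m_sigma_additive.

Let m_fin : fin_num_fun (dominated_measure H).
Proof. by []. Qed.

HB.instance Definition _ := @Measure_isFinite.Build _ T _ (dominated_measure H) m_fin.

Lemma dominated_density : exists f : T -> \bar R,
  [/\ forall x, (0 <= f x)%E, nu.-integrable setT f
    & forall E, measurable E -> (m E)%:E = (\int[nu]_(x in E) f x)%E].
Proof.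
have dom : dominated_measure H `<< nu.
  apply/null_content_dominatesP => A mA nuA0; apply/eqP; rewrite eq_le m_ge0 andbT.
  by rewrite -nuA0; have [_ _] := H; apply.
exact: (radon_nikodym_finite dom).
Qed.

End dominated_measure.

Section ae_le.
Context d (T : measurableType d) (R : realType) (mu : {finite_measure set T -> \bar R}).
Local Open Scope ereal_scope.

(** On the set where [g < f], the hypothesis and the pointwise order make all integrals of [f] and
    [g] equal, so [f = g] almost everywhere on it. *)
Lemma integral_le_ae (f g : T -> \bar R) : mu.-integrable setT f ->
  mu.-integrable setT g ->
  (forall E, measurable E -> \int[mu]_(x in E) f x <= \int[mu]_(x in E) g x) ->
  {ae mu, forall x, f x <= g x}.
Proof.
move=> fi gi fg; have mf := measurable_int _ fi; have mg := measurable_int _ gi.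
pose D := [set x | g x < f x].
have mD : measurable D.
  by rewrite -[D]setTI; exact: emeasurable_fun_lt.
have : ae_eq mu D f g.
  apply: integral_ae_eq => //.
  - exact: integrableS fi.
  - exact: measurable_funTS.
  move=> E ED mE; apply/eqP; rewrite eq_le fg//=.
  apply: le_integral => //.
  - exact: integrableS gi.
  - exact: integrableS fi.
  - by move=> x /set_mem /ED /ltW.
apply: filterS => x Dx; rewrite leNgt; apply/negP => fx.
by have := Dx fx => fge; rewrite fge ltxx in fx.
Qed.

End ae_le.

Definition unit_uniform (R : realType) : probability (measurableTypeR R) R :=
  uniform_prob (@ltr01 R).

Lemma unit_uniform_ray (R : realType) (a : R) : 0 <= a <= 1 ->
  unit_uniform R `]-oo, a]%classic = a%:E.
Proof.
move=> /andP[a0 a1]; rewrite /unit_uniform /= /uniform_prob integral_uniform_pdf.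
have -> : `]-oo, a]%classic `&` `[0, 1]%classic = `[0, a]%classic :> set R.
  apply/seteqP; split => x /=; rewrite !in_itv/=.
    by move=> [-> /andP[->]].
  by move=> /andP[-> xa]; rewrite xa (le_trans xa).
rewrite (eq_integral (fun=> 1%:E)).
  rewrite integral_cst//= lebesgue_measure_itv/= mul1e lte_fin.
  by case: ltgtP a0 => // [_|<-]; rewrite ?sube0.
move=> x /set_mem /=; rewrite in_itv/= /uniform_pdf => /andP[-> xa].
by rewrite (le_trans xa)// subr0 invr1.
Qed.

(** Open rays are stable under intersection and generate the Borel sets. The two measures live on
    different spaces; only their images on the line are compared. *)
Lemma measure_eq_rays d1 d2 (T1 : measurableType d1) (T2 : measurableType d2)
    (R : realType) (m1 : {measure set T1 -> \bar R})
    (m2 : {measure set T2 -> \bar R}) (f1 : {mfun T1 >-> R})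
    (f2 : {mfun T2 >-> R}) : (m1 setT < +oo)%E ->
  (forall t, m1 (f1 @^-1` `]-oo, t[%classic) = m2 (f2 @^-1` `]-oo, t[%classic)) ->
  forall C : set R, measurable C -> m1 (f1 @^-1` C) = m2 (f2 @^-1` C).
Proof.
move=> m1oo H C mC.
have := @measure_unique _ R R (@RGenInftyO.G R)
  (fun n => `]-oo, n%:R[%classic) _ _ _ _
  (pushforward m1 f1) (pushforward m2 f2) _ _ C mC.
apply.
- exact: RGenInftyO.measurableE.
- move=> _ _ [x ->] [y ->]; exists (Num.min x y).
  by apply/seteqP; split => z /=; rewrite !in_itv/= lt_min; [move=> [-> ->]|move=> /andP].
- by move=> n; exists n%:R.
- apply/seteqP; split => // x _; exists (Num.truncn `|x|).+1 => //=.
  by rewrite in_itv/= (le_lt_trans (ler_norm x))// truncnS_gt.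
- by move=> _ [x ->]; exact: H.
- move=> n; apply: (le_lt_trans _ m1oo).
  apply: (@le_measure _ _ _ m1); rewrite ?inE//.
  exact: (measurable_funPTI f1).
Qed.

Section unit_rationals.
Context (R : realType).

(** Rationals outside the unit interval are replaced by 1, so that every index gives a level in the
    interval. *)
Definition unit_rational (n : nat) : R :=
  let r := ratr (odflt 0 (@unpickle rat n)) in if 0 <= r <= 1 then r else 1.

Lemma unit_rational01 n : 0 <= unit_rational n <= 1.
Proof. by rewrite /unit_rational; case: ifPn => // _; rewrite ler01 lexx. Qed.

Lemma unit_rational_dense (a t : R) : 0 <= a -> a < t -> t <= 1 ->
  exists n, a <= unit_rational n < t.
Proof.
move=> a0 at_ t1; have [q] := rat_in_itvoo at_.
rewrite in_itv/= => /andP[aq qt]; exists (pickle q).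
rewrite /unit_rational pickleK/= (le_trans a0 (ltW aq)) (le_trans (ltW qt) t1)/=.
by rewrite (ltW aq).
Qed.

End unit_rationals.

(** * Realization of a bimeasure by a quantile map *)

Section quantile.
Context dX (X : measurableType dX) dY (Y : measurableType dY) (R : realType).
Context (mu : probability X R) (nu : probability Y R).
Context (sigma : set X -> set Y -> R).
Hypothesis sigmaX : forall B, dominated_additive mu (sigma ^~ B).
Hypothesis sigmaY : forall A, dominated_additive nu (sigma A).
Hypothesis sigmaT : forall A, measurable A -> (sigma A setT)%:E = mu A.
Context (s : Y -> R).
Hypothesis ms : measurable_fun setT s.
Hypothesis s01 : forall y, 0 <= s y <= 1.

Local Notation rho := (@unit_rational R).
Local Notation S n := (s @^-1` `]-oo, rho n]%classic).
Local Notation U := (unit_uniform R).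

Lemma sigma_mono A B B' : B `<=` B' -> sigma A B <= sigma A B'.
Proof.
move=> BB'; have [ge0 add _] := sigmaY A.
rewrite -(setDUK BB') add ?setDIK// lerDl; exact: ge0.
Qed.

(** [F n x] is the conditional probability, given [x], of [s <= rho n]. The densities satisfy the
    countably many required relations off one null set, and there all of them are replaced by 0,
    which keeps them monotone in the level. *)
Lemma conditional_cdf : exists F : nat -> X -> R,
  [/\ forall n, measurable_fun setT (F n), forall n x, 0 <= F n x <= 1,
      forall n m x, rho n <= rho m -> F n x <= F m x
    & forall n A, measurable A ->
        (\int[mu]_(x in A) (F n x)%:E)%E = (sigma A (S n))%:E].
Proof.
have [F0 HF0] := choice (fun n => dominated_density (sigmaX (S n))).
pose P x := forall n, (F0 n x <= 1)%E /\
  forall m, rho n <= rho m -> (F0 n x <= F0 m x)%E.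
have aeP : {ae mu, forall x, P x}.
  apply/ae_foralln => n; have [_ fin fint] := HF0 n.
  have [| |] := @integral_le_ae _ _ _ mu (F0 n) (cst 1%E) fin.
  - exact: finite_measure_integrable_cst.
  - move=> E mE; rewrite -fint// integral_cst// mul1e.
    by have [_ _] := sigmaX (S n); apply.
  - move=> N [mN N0 sN].
    have : {ae mu, forall x m, rho n <= rho m -> (F0 n x <= F0 m x)%E}.
      apply/ae_foralln => m; have [_ fim fimt] := HF0 m.
      have [nm|nm] := boolP (rho n <= rho m); last by apply: aeW.
      have := @integral_le_ae _ _ _ mu (F0 n) (F0 m) fin fim.
      move=> H; apply: filterS (H _); first by move=> x + _; exact.
      move=> E mE; rewrite -fint// -fimt// lee_fin; apply: sigma_mono.
      by move=> y /=; rewrite !in_itv/= => /le_trans; exact.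
    apply: filterS2; last by exists N; split; [exact: mN|exact: N0|exact: sN].
    by move=> x h1 h2; split => //; exact: h1.
have [N [mN N0 NP]] := aeP.
have PN x : ~ N x -> P x by move=> Nx; apply: contrapT => /NP.
exists (fun n x => \1_(~` N) x * fine (F0 n x)); split.
- move=> n; apply: measurable_funM.
    by apply: measurable_indic; exact: measurableC.
  apply: measurableT_comp => //; have [_ fi _] := HF0 n.
  exact: measurable_int fi.
- move=> n x; rewrite indicE; case: (boolP (x \in _)) => [|_]; last first.
    by rewrite mul0r lexx ler01.
  rewrite inE mul1r => /PN /(_ n) [h _]; have [ge0 _ _] := HF0 n.
  by move: h (ge0 x); case: (F0 n x) => //= r; rewrite !lee_fin => -> ->.
- move=> n m x nm; rewrite indicE; case: (boolP (x \in _)) => [|_]; last first.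
    by rewrite !mul0r.
  rewrite inE !mul1r => /PN Px; have [_ /(_ m nm)] := Px n.
  have [n1 _] := Px n; have [m1 _] := Px m.
  have [gen _ _] := HF0 n; have [gem _ _] := HF0 m.
  move: n1 m1 (gen x) (gem x).
  by case: (F0 n x) => // a; case: (F0 m x).
- move=> n A mA; have [ge0 fi ->//] := HF0 n; apply: ae_eq_integral => //.
  + apply: measurable_funTS; apply/measurable_EFinP; apply: measurable_funM.
      by apply: measurable_indic; exact: measurableC.
    apply: measurableT_comp => //; exact: measurable_int fi.
  + by apply: measurable_funTS; exact: measurable_int fi.
  + exists N; split => // x /= H; apply: contrapT => nNx; apply: H => _.
    rewrite indicE mem_set// mul1r fineK//.
    have [h _] := PN _ nNx n; rewrite ge0_fin_numE//.
    by apply: le_lt_trans h _; rewrite ltry.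
Qed.

(** [Q (x, u) < t] holds exactly when [u <= F n x] for some level [rho n < t], at least for
    [t <= 1]. Exhausting these levels and the event [s < t] by finitely many levels at a time
    matches the two measures on open rays, and rays determine them. *)
Lemma quantile_function : exists Q : X * measurableTypeR R -> R,
  measurable_fun setT Q /\
  forall A C, measurable A -> measurable C ->
    (mu \x U)%E ((A `*` setT) `&` Q @^-1` C) = (sigma A (s @^-1` C))%:E.
Proof.
have [F [mF F01 Fmono Fint]] := conditional_cdf.
(* Levels that are not admissible count as 1, so [Q] is the infimum of the admissible levels and is
   1 if there are none. *)
pose h n (z : X * measurableTypeR R) : R := if z.2 <= F n z.1 then rho n else 1.
have h01 n z : 0 <= h n z <= 1.
  by rewrite /h; case: ifPn => _; [exact: unit_rational01|rewrite ler01 lexx].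
pose Q z := infs (h ^~ z) 0%N.
have lbh z : has_lbound (range (h ^~ z)).
  by exists 0 => _ [n _ <-]; case/andP: (h01 n z).
have mW n : measurable [set z : X * measurableTypeR R | z.2 <= F n z.1].
  have := @measurable_fun_ler _ (X * measurableTypeR R)%type R setT snd (F n \o fst).
  move=> /(_ measurable_snd (measurableT_comp (mF n) measurable_fst)).
  by move=> /(_ measurableT [set true] I); rewrite setTI.
have mQ : measurable_fun setT Q.
  apply: measurable_fun_infs => [z _|n]; first exact: lbh.
  apply: measurable_fun_ifT => //.
  apply: measurable_fun_ler => //.
  by apply: measurableT_comp => //; exact: mF.
exists Q; split => // A C mA; move: C.
have Qlt t z : t <= 1 -> (Q z < t) <-> exists n, rho n < t /\ z.2 <= F n z.1.
  move=> t1; rewrite /Q /infs /sdrop /=; split.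
    move=> /inf_lt[|_ [n _ <-]].
      by exists (h 0%N z), 0%N.
    rewrite /h; case: ifPn => [zF rt|_ /lt_le_trans/(_ t1)]; last by rewrite ltxx.
    by exists n.
  move=> [n [nt zF]]; apply: le_lt_trans nt; apply: ge_inf.
    by have [b Hb] := lbh z; exists b => _ [m _ <-]; apply: Hb; exists m.
  by exists n => //; rewrite /h zF.
(* For fixed [x] in [A] the section is the ray ending at [F m x], and its uniform measure is
   [F m x]. *)
have Wm m : (mu \x U)%E [set z | A z.1 /\ z.2 <= F m z.1] = (sigma A (S m))%:E.
  rewrite -Fint// [RHS]integral_mkcond /product_measure1; apply: eq_integral => x _ /=.
  rewrite patchE; case: ifPn => [/set_mem Ax|/negP nAx].
    rewrite -unit_uniform_ray//; congr (unit_uniform R _).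
    apply/seteqP; split => u; rewrite xsectionE/= in_itv/=; first by case.
    by move=> h'; split.
  rewrite (_ : xsection _ _ = set0) ?measure0//.
  apply/seteqP; split => // u; rewrite xsectionE /= => -[Ax _].
  by apply: nAx; rewrite inE.
have ray t : t <= 1 ->
    (mu \x U)%E ((A `*` setT) `&` Q @^-1` `]-oo, t[%classic) =
    (sigma A (s @^-1` `]-oo, t[%classic))%:E.
  move=> t1.
  pose V k := [set y | exists n, [/\ (n < k)%N, rho n < t & s y <= rho n]].
  pose W k := [set z : X * measurableTypeR R |
    A z.1 /\ exists n, [/\ (n < k)%N, rho n < t & z.2 <= F n z.1]].
  (* Among finitely many levels below [t] the largest absorbs the others, in [V] by transitivity and
     in [W] by monotonicity of [F]. *)
  have VW k : (V k = set0 /\ W k = set0) \/ exists m, [/\ rho m < t, V k = S m &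
      W k = [set z | A z.1 /\ z.2 <= F m z.1]].
    elim: k => [|k IH].
      left; split; apply/seteqP; split => // z; first by move=> [n []].
      by move=> [_ [n []]].
    have [kt|kt] := ltP (rho k) t; last first.
      suff [-> ->] : V k.+1 = V k /\ W k.+1 = W k by [].
      split; apply/seteqP; split => z.
      - move=> [n [+ nt zn]]; rewrite ltnS leq_eqVlt => /orP[/eqP nk|nk].
          by rewrite nk ltNge kt in nt.
        by exists n.
      - by move=> [n [nk nt zn]]; exists n; split => //; exact: ltnW.
      - move=> [Az [n [+ nt zn]]]; rewrite ltnS leq_eqVlt => /orP[/eqP nk|nk].
          by rewrite nk ltNge kt in nt.
        by split => //; exists n.
      - move=> [Az [n [nk nt zn]]]; split => //.
        by exists n; split => //; exact: ltnW.
    have VS : V k.+1 = V k `|` S k.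
      apply/seteqP; split => z.
        move=> [n [+ nt zn]]; rewrite ltnS leq_eqVlt => /orP[/eqP nk|nk].
          by right; rewrite /= in_itv/= -nk.
        by left; exists n.
      move=> [[n [nk nt zn]]|]; first by exists n; split => //; exact: ltnW.
      by rewrite /= in_itv/= => zk; exists k.
    have WS : W k.+1 = W k `|` [set z | A z.1 /\ z.2 <= F k z.1].
      apply/seteqP; split => z.
        move=> [Az [n [+ nt zn]]]; rewrite ltnS leq_eqVlt => /orP[/eqP nk|nk].
          by right; split => //; rewrite -nk.
        by left; split => //; exists n.
      move=> [[Az [n [nk nt zn]]]|[Az zk]]; split => //; last by exists k.
      by exists n; split => //; exact: ltnW.
    rewrite VS WS; right; case: IH => [[-> ->]|[m [mt -> ->]]].
      by exists k; rewrite !set0U.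
    have [mk|/ltW km] := leP (rho m) (rho k); [exists k|exists m]; split => //.
    - by apply/setUidr => y /=; rewrite !in_itv/= => /le_trans; exact.
    - by apply/setUidr => z [Az zm]; split => //; apply: le_trans zm _; exact: Fmono.
    - by apply/setUidl => y /=; rewrite !in_itv/= => /le_trans; exact.
    - by apply/setUidl => z [Az zm]; split => //; apply: le_trans zm _; exact: Fmono.
  have mVW k : [/\ measurable (V k), measurable (W k) &
      (mu \x U)%E (W k) = (sigma A (V k))%:E].
    case: (VW k) => [[-> ->]|[m [mt -> ->]]]; split => //.
    - by rewrite measure0 (dominated_additive0 (sigmaY A)).
    - by rewrite -[X in measurable X]setTI; exact: ms.
    - rewrite (_ : [set z | _] = (A `*` setT) `&` [set z | z.2 <= F m z.1]).
        by apply: measurableI => //; exact: measurableX.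
      by apply/seteqP; split => z /= => [[]|[[]]].
  have EV : s @^-1` `]-oo, t[%classic = \bigcup_k V k.
    apply/seteqP; split => y /=; rewrite in_itv/=.
      move=> yt; have [n /andP[yn nt]] := unit_rational_dense (andP (s01 y)).1 yt t1.
      by exists n.+1 => //; exists n.
    by move=> [k _ [n [_ nt yn]]]; exact: le_lt_trans nt.
  have EW : (A `*` setT) `&` Q @^-1` `]-oo, t[%classic = \bigcup_k W k.
    apply/seteqP; split => z /=; rewrite in_itv/=.
      by move=> [[Az _] /(Qlt _ _ t1)[n [nt zn]]]; exists n.+1 => //; split => //; exists n.
    move=> [k _ [Az [n [nk nt zn]]]]; split => //.
    by apply/(Qlt _ _ t1); exists n.
  have ndV : nondecreasing_seq V.
    move=> i j ij; apply/subsetPset => y [n [ni nt yn]]; exists n; split => //.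
    exact: leq_trans ij.
  have ndW : nondecreasing_seq W.
    move=> i j ij; apply/subsetPset => y [Ay [n [ni nt yn]]]; split => //.
    by exists n; split => //; exact: leq_trans ij.
  rewrite EV EW.
  have mV k : measurable (V k) by have [] := mVW k.
  have mWk k : measurable (W k) by have [] := mVW k.
  have c1 := nondecreasing_cvg_mu (mu := dominated_measure (sigmaY A)) mV
    (bigcupT_measurable V mV) ndV.
  have c2 := nondecreasing_cvg_mu (mu := (mu \x U)%E) mWk (bigcupT_measurable W mWk) ndW.
  apply: (cvg_unique _ c2) => //.
  suff -> : (mu \x U)%E \o W = dominated_measure (sigmaY A) \o V by exact: c1.
  by apply/funext => k /=; have [_ _ ->] := mVW k.
(* Both [s] and [Q] are at most 1, so beyond 1 both preimages are the whole space. *)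
have rayT t : 1 < t ->
    (mu \x U)%E ((A `*` setT) `&` Q @^-1` `]-oo, t[%classic) =
    (sigma A (s @^-1` `]-oo, t[%classic))%:E.
  move=> t1.
  have -> : s @^-1` `]-oo, t[%classic = setT.
    apply/seteqP; split => // y _; rewrite /= in_itv/=; apply: le_lt_trans t1.
    by case/andP: (s01 y).
  have -> : Q @^-1` `]-oo, t[%classic = setT.
    apply/seteqP; split => // z _; rewrite /= in_itv/=; apply: le_lt_trans t1.
    apply: (@le_trans _ _ (h 0%N z)); last by case/andP: (h01 0%N z).
    apply: ge_inf; last by exists 0%N.
    by have [b Hb] := lbh z; exists b => _ [m _ <-]; apply: Hb; exists m.
  rewrite setIT sigmaT// product_measure1E// -[RHS]mule1; congr (_ * _)%E.
  exact: probability_setT.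
pose AT := A `*` [set: measurableTypeR R].
have mAT : measurable AT by exact: measurableX.
have mUT : (mu \x U)%E [set: X * measurableTypeR R] = 1%E.
  rewrite -setXTT product_measure1E// -[RHS]mule1.
  by congr (_ * _)%E; exact: probability_setT.
pose Qm : {mfun _ >-> R} := mfun_Sub (mem_set mQ).
pose sm : {mfun _ >-> R} := mfun_Sub (mem_set ms).
pose m1 : {measure set (X * measurableTypeR R) -> \bar R} := mrestr (mu \x U)%E mAT.
have m1E C : m1 C = (mu \x U)%E (AT `&` C) by rewrite setIC.
move=> C mC; rewrite -m1E.
apply: (@measure_eq_rays _ _ _ _ _ m1 (dominated_measure (sigmaY A)) Qm sm _ _ C mC).
  rewrite m1E setIT; apply: (@le_lt_trans _ _ 1%E); last by rewrite ltry.
  by rewrite -mUT; apply: le_measure; rewrite ?inE.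
move=> t; rewrite m1E; have [t1|t1] := leP t 1; first exact: ray.
exact: rayT.
Qed.

End quantile.

(** * The coupling functional *)

Section real_integrable.
Context d (T : measurableType d) (R : realType).

Definition rintegrable (m : set T -> \bar R) (f : T -> R) :=
  m.-integrable setT (EFin \o f).

Definition bounded_measurable (f : T -> R) :=
  measurable_fun setT f /\ exists M, forall x, `|f x| <= M.

Context (m : {finite_measure set T -> \bar R}).

Lemma rintegrable_lin t f g : rintegrable m f -> rintegrable m g ->
  rintegrable m (fun x => t * f x + g x).
Proof.
move=> mf mg; rewrite /rintegrable.
rewrite (_ : EFin \o _ = (fun x => t%:E * (EFin \o f) x + (EFin \o g) x)%E).
  by apply: integrableD => //; exact: integrableZl.
by apply/funext => x /=; rewrite EFinD EFinM.
Qed.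

Lemma rintegrable0 : rintegrable m (fun=> 0).
Proof. exact: integrable0. Qed.

Lemma rintegral_lin t f g : rintegrable m f -> rintegrable m g ->
  \int[m]_x (t * f x + g x) = t * \int[m]_x f x + \int[m]_x g x.
Proof.
move=> mf mg; rewrite RintegralD//; last first.
  have := rintegrable_lin t mf rintegrable0; rewrite /rintegrable.
  by congr (integrable _ _ _); apply/funext => x /=; rewrite addr0.
by rewrite RintegralZl.
Qed.

Lemma rintegrable_cst c : rintegrable m (fun=> c).
Proof. exact: finite_measure_integrable_cst. Qed.

Lemma rintegrable_sum n (f : 'I_n -> T -> R) : (forall i, rintegrable m (f i)) ->
  rintegrable m (fun x => \sum_i f i x).
Proof.
move=> mf; rewrite /rintegrable.
rewrite (_ : EFin \o _ = (fun x => \sum_(i < n) (EFin \o f i) x)%E).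
  by apply: integrable_sum => // i _; exact: mf.
by apply/funext => x /=; rewrite sumEFin.
Qed.

Lemma bounded_measurableM f g : bounded_measurable f -> rintegrable m g ->
  rintegrable m (fun x => f x * g x).
Proof.
move=> [mf [M fM]] gi; have mg : measurable_fun setT g.
  by have := measurable_int _ gi => /measurable_EFinP.
apply: (@le_integrable _ _ _ m setT _ _ (fun x => M%:E * (EFin \o g) x)%E) => //.
- by apply/measurable_EFinP; exact: measurable_funM.
- move=> x _ /=; rewrite lee_fin !normrM ler_wpM2r//.
  by rewrite (le_trans (fM x))// ler_norm.
- exact: integrableZl.
Qed.

Lemma bounded_rintegrable f : bounded_measurable f -> rintegrable m f.
Proof.
move=> bf; have := bounded_measurableM bf (rintegrable_cst 1).
by congr (integrable _ _ _); apply/funext => x /=; rewrite mulr1.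
Qed.

Lemma bounded_measurable_lin t f g : bounded_measurable f ->
  bounded_measurable g -> bounded_measurable (fun x => t * f x + g x).
Proof.
move=> [mf [M fM]] [mg [N gN]]; split.
  by apply: measurable_funD => //; exact: measurable_funM.
exists (`|t| * M + N) => x; rewrite (le_trans (ler_normD _ _))// lerD// normrM.
exact: ler_wpM2l.
Qed.

Lemma bounded_measurable_cst c : bounded_measurable (fun=> c).
Proof. by split => //; exists `|c|. Qed.

Lemma bounded_measurable_indic (A : set T) : measurable A ->
  bounded_measurable \1_A.
Proof.
move=> mA; split; first exact: measurable_indic.
by exists 1 => x; rewrite indicE; case: (_ \in _); rewrite ?normr1 ?normr0.
Qed.

End real_integrable.

Definition dominated_fun (V : Type) dY (Y : measurableType dY) (R : realType)
    (nu : set Y -> \bar R) (u : V * Y -> R) :=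
  exists2 psi, rintegrable nu psi & forall z, `|u z| <= psi z.2.

Section coupling_functional.
Context dX (X : measurableType dX) dY (Y : measurableType dY) (R : realType).
Context (mu : probability X R) (nu : probability Y R) (n : nat).
Context (T : X -> 'I_n -> R) (F : Y -> 'I_n -> R).
Hypothesis iT : forall i, rintegrable mu (T ^~ i).
Hypothesis iF : forall i, rintegrable nu (F ^~ i).
Hypothesis affine_le : forall (a : X -> R) (b : 'I_n -> X -> R) (psi : Y -> R),
  bounded_measurable a -> (forall i, bounded_measurable (b i)) ->
  rintegrable nu psi ->
  (forall x y, a x + \sum_i b i x * F y i <= psi y) ->
  \int[mu]_x (a x + \sum_i b i x * T x i) <= \int[nu]_y psi y.

Lemma coupling_functional : exists L : (X * Y -> R) -> R,
  [/\ forall t u v, dominated_fun nu u -> dominated_fun nu v ->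
        L (fun z => t * u z + v z) = t * L u + L v,
      forall u psi, dominated_fun nu u -> rintegrable nu psi ->
        (forall z, u z <= psi z.2) -> L u <= \int[nu]_y psi y
    & forall a b, bounded_measurable a -> (forall i, bounded_measurable (b i)) ->
        L (fun z => a z.1 + \sum_i b i z.1 * F z.2 i) =
        \int[mu]_x (a x + \sum_i b i x * T x i)].
Proof.
pose p (u : X * Y -> R) := inf [set r | exists psi,
  [/\ rintegrable nu psi, forall z, u z <= psi z.2 & r = \int[nu]_y psi y]].
(* A relation rather than a function: different [(a, b)] may give the same function of [(x, y)], and
   independence of the value follows from domination. *)
pose G0 : set ((X * Y -> R) * R) := [set e | exists a b,
  [/\ bounded_measurable a, forall i, bounded_measurable (b i),
    e.1 = (fun z => a z.1 + \sum_i b i z.1 * F z.2 i)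
  & e.2 = \int[mu]_x (a x + \sum_i b i x * T x i)]].
have E_lin t (u v : X * Y -> R) : dominated_fun nu u -> dominated_fun nu v ->
    dominated_fun nu (t *: u + v).
  move=> [psi ipsi upsi] [phi iphi vphi].
  exists (fun y => `|t| * psi y + phi y); first exact: rintegrable_lin.
  move=> z; rewrite !fctE (le_trans (ler_normD _ _))// lerD// normrM.
  exact: ler_wpM2l.
(* If [|u| <= psi] and [phi] is a majorant of [u], then [-psi <= phi]; fixing a point of [X] turns
   this into an inequality in [y] alone. *)
have lbp (u : X * Y -> R) : dominated_fun nu u -> has_lbound [set r | exists psi,
    [/\ rintegrable nu psi, forall z, u z <= psi z.2 & r = \int[nu]_y psi y]].
  move=> [psi ipsi upsi]; exists (\int[nu]_y (-1 * psi y + 0)).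
  move=> _ [phi [iphi uphi ->]]; apply: le_Rintegral => //.
    by apply: rintegrable_lin => //; exact: rintegrable0.
  move=> y _; rewrite addr0 mulN1r; have := upsi (point : X, y); have := uphi (point : X, y).
  by move=> /=; rewrite ler_norml => h /andP[h1 _]; exact: le_trans h.
have p_le u psi : dominated_fun nu u -> rintegrable nu psi ->
    (forall z, u z <= psi z.2) -> p u <= \int[nu]_y psi y.
  by move=> Eu ipsi upsi; apply: ge_inf; [exact: lbp|exists psi].
have le_p u r : dominated_fun nu u -> (forall psi, rintegrable nu psi ->
    (forall z, u z <= psi z.2) -> r <= \int[nu]_y psi y) -> r <= p u.
  move=> [psi ipsi upsi] H; apply: lb_le_inf.
    exists (\int[nu]_y psi y), psi; split => // z.
    by rewrite (le_trans _ (upsi z))// ler_norm.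
  by move=> _ [phi [iphi uphi ->]]; exact: H.
have p_add u v : dominated_fun nu u -> dominated_fun nu v -> p (u + v) <= p u + p v.
  move=> Eu Ev; rewrite -lerBlDr; apply: (le_p) => // psi ipsi upsi.
  rewrite lerBlDr -lerBlDl; apply: (le_p) => // phi iphi vphi.
  rewrite lerBlDl -[X in _ <= X + _]mul1r -rintegral_lin//; apply: p_le.
  - by have := E_lin 1 u v Eu Ev; rewrite scale1r.
  - exact: rintegrable_lin.
  - by move=> z; rewrite mul1r fctE lerD.
have p_scale t u : 0 < t -> dominated_fun nu u -> p (t *: u) <= t * p u.
  move=> t0 Eu; rewrite -ler_pdivrMl//; apply: (le_p) => // psi ipsi upsi.
  rewrite ler_pdivrMl// -RintegralZl//.
  have -> : \int[nu]_y (t * psi y) = \int[nu]_y (t * psi y + 0).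
    by apply: eq_Rintegral => y _; rewrite addr0.
  apply: p_le.
  - have := E_lin t u (fun=> 0) Eu; rewrite (_ : t *: u + _ = t *: u).
      apply; exists (fun=> 0); first exact: rintegrable0.
      by move=> z; rewrite normr0.
    by apply/funext => z; rewrite !fctE addr0.
  - by apply: rintegrable_lin => //; exact: rintegrable0.
  - by move=> z; rewrite addr0 fctE ler_pM2l.
have G0d : dominated_graph (dominated_fun nu) p G0.
  split.
  - exists (fun=> 0), (fun=> fun=> 0); split => //=.
    + exact: bounded_measurable_cst.
    + by move=> i; exact: bounded_measurable_cst.
    + by apply/funext => z; rewrite big1 ?addr0// => i _; rewrite mul0r.
    + under eq_Rintegral do (rewrite big1 ?addr0; last by move=> i _; rewrite mul0r).
      by rewrite Rintegral_cst// mul0r.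
  - move=> t u v r s [a [b [/= ba bb -> ->]]] [a' [b' [/= ba' bb' -> ->]]].
    exists (fun x => t * a x + a' x), (fun i x => t * b i x + b' i x); split => /=.
    + exact: bounded_measurable_lin.
    + by move=> i; exact: bounded_measurable_lin.
    + apply/funext => z; rewrite -[LHS]/(t * (_ + _) + (_ + _)).
      rewrite mulrDr addrACA mulr_sumr -big_split/=.
      by congr (_ + _); apply: eq_bigr => i _; rewrite mulrDl mulrA.
    + have iab a1 b1 : bounded_measurable a1 ->
          (forall i, bounded_measurable (b1 i)) ->
          rintegrable mu (fun x => a1 x + \sum_i b1 i x * T x i).
        move=> h1 h2; have := @rintegrable_lin _ _ _ mu 1 a1
          (fun x => \sum_i b1 i x * T x i).
        rewrite /rintegrable; under [X in _ -> _ -> integrable _ _ X]eq_fun do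
          rewrite /= mul1r.
        apply; first exact: bounded_rintegrable.
        by apply: rintegrable_sum => i; exact: bounded_measurableM.
      rewrite -rintegral_lin; [|exact: iab|exact: iab].
      apply: eq_Rintegral => x _.
      rewrite mulrDr addrACA mulr_sumr -big_split/=.
      by congr (_ + _); apply: eq_bigr => i _; rewrite mulrDl mulrA.
  - move=> u r [a [b [/= ba bb -> ->]]].
    have Eab : dominated_fun nu (fun z => a z.1 + \sum_i b i z.1 * F z.2 i).
      have [ma [M aM]] := ba.
      have /choice[N bN] i : exists N, forall x, `|b i x| <= N by have [_] := bb i.
      exists (fun y => M + \sum_i N i * `|F y i|).
        have := @rintegrable_lin _ _ _ nu 1 (fun=> M) (fun y => \sum_i N i * `|F y i|).
        rewrite /rintegrable; under [X in _ -> _ -> integrable _ _ X]eq_fun do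
          rewrite /= mul1r.
        apply; first exact: rintegrable_cst.
        apply: rintegrable_sum => i.
        have := @rintegrable_lin _ _ _ nu (N i) (fun y => `|F y i|) (fun=> 0).
        rewrite /rintegrable; under [X in _ -> _ -> integrable _ _ X]eq_fun do
          rewrite /= addr0.
        apply; last exact: rintegrable0.
        by have := integrable_abse (iF i).
      move=> z; rewrite (le_trans (ler_normD _ _))// lerD//.
      rewrite (le_trans (ler_norm_sum _ _ _))// ler_sum// => i _.
      by rewrite normrM ler_wpM2r.
    split => //; apply: (le_p) => // psi ipsi upsi; apply: affine_le => // x y.
    exact: (upsi (x, y)).
have [L [Llin Lp LG]] := hahn_banach E_lin p_add p_scale G0d.
exists L; split.
- exact: Llin.
- by move=> u psi Eu ipsi upsi; apply: le_trans (Lp u Eu) _; exact: p_le.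
- by move=> a b ba bb; apply: LG; exists a, b.
Qed.

End coupling_functional.

(** * The bimeasure of the functional, and integrals against its realization *)

Section functional_bimeasure.
Import finmap HBNNSimple.
Context dX (X : measurableType dX) dY (Y : measurableType dY) (R : realType).
Context (mu : probability X R) (nu : probability Y R).
Context (L : (X * Y -> R) -> R).
Hypothesis L_lin : forall t u v, dominated_fun nu u -> dominated_fun nu v ->
  L (fun z => t * u z + v z) = t * L u + L v.
Hypothesis L_le : forall u psi, dominated_fun nu u -> rintegrable nu psi ->
  (forall z, u z <= psi z.2) -> L u <= \int[nu]_y psi y.
Hypothesis L_fst : forall A, measurable A ->
  L (fun z => \1_A z.1) = \int[mu]_x \1_A x.

Local Notation dom := (@dominated_fun X _ Y R nu).

Lemma dominated_fun0 : dom (fun=> 0).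
Proof. by exists (fun=> 0); [exact: rintegrable0|move=> z; rewrite normr0]. Qed.

Lemma dominated_fun_lin t u v : dom u -> dom v -> dom (fun z => t * u z + v z).
Proof.
move=> [psi ipsi upsi] [phi iphi vphi].
exists (fun y => `|t| * psi y + phi y); first exact: rintegrable_lin.
move=> z; rewrite (le_trans (ler_normD _ _))// lerD// normrM.
exact: ler_wpM2l.
Qed.

Lemma rintegrable_norm (g : Y -> R) : rintegrable nu g ->
  rintegrable nu (fun y => `|g y|).
Proof. by move=> ig; have := integrable_abse ig. Qed.

Lemma dominated_fun_indicM A (g : Y -> R) : rintegrable nu g ->
  dom (fun z => \1_A z.1 * g z.2).
Proof.
move=> ig; exists (fun y => `|g y|); first exact: rintegrable_norm.
move=> z; rewrite normrM indicE; case: (_ \in _) => /=.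
  by rewrite normr1 mul1r.
by rewrite normr0 mul0r.
Qed.

Lemma dominated_fun_indic2 (A : set X) (B : set Y) : dom (fun z => \1_A z.1 * \1_B z.2).
Proof.
exists (fun=> 1); first exact: rintegrable_cst.
move=> z; rewrite normrM !indicE; case: (_ \in _) => /=; last by rewrite normr0 mul0r.
by case: (_ \in _); rewrite normr1 mul1r ?normr1 ?normr0.
Qed.

Lemma functional0 : L (fun=> 0) = 0.
Proof.
have := L_lin (-1) dominated_fun0 dominated_fun0.
rewrite (_ : (fun z => _) = fun=> 0); first by lra.
by apply/funext => z; rewrite mulr0 addr0.
Qed.

(** The difference [u - v] has the majorant 0. *)
Lemma functional_mono u v : dom u -> dom v -> (forall z, u z <= v z) -> L u <= L v.
Proof.
move=> du dv uv.
have : L (fun z => (-1) * v z + u z) <= \int[nu]_y 0.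
  apply: L_le; [exact: dominated_fun_lin|exact: rintegrable0|].
  by move=> z; have := uv z; lra.
by rewrite L_lin// Rintegral_cst// mul0r; lra.
Qed.

Lemma functional_snd g : rintegrable nu g -> L (fun z => g z.2) = \int[nu]_y g y.
Proof.
move=> ig; have dg : dom (fun z => g z.2).
  exists (fun y => `|g y|); first exact: rintegrable_norm.
  by [].
apply/eqP; rewrite eq_le L_le//=.
have : L (fun z => (-1) * g z.2 + 0) <= \int[nu]_y ((-1) * g y + 0).
  apply: L_le => //; first exact: (dominated_fun_lin (-1) dg dominated_fun0).
  by apply: rintegrable_lin => //; exact: rintegrable0.
rewrite (L_lin (-1) dg dominated_fun0) functional0.
rewrite rintegral_lin//; last exact: rintegrable0.
by rewrite Rintegral_cst// mul0r; lra.
Qed.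

Definition functional_bimeasure A B : R := L (fun z => \1_A z.1 * \1_B z.2).
Local Notation sigma := functional_bimeasure.

Lemma functional_bimeasure_ge0 A B : 0 <= sigma A B.
Proof.
rewrite -functional0; apply: functional_mono; first exact: dominated_fun0.
  exact: dominated_fun_indic2.
by move=> z; rewrite mulr_ge0.
Qed.

Lemma indicU_disjoint (V : Type) (A B : set V) : A `&` B = set0 ->
  \1_(A `|` B) = (fun x => \1_A x + \1_B x) :> (V -> R).
Proof.
move=> AB; apply/funext => x; rewrite !indicE in_setU.
case: (boolP (x \in A)) => //= [/set_mem Ax|_]; last by rewrite add0r.
case: (boolP (x \in B)) => [/set_mem Bx|]; last by rewrite addr0.
by have : (A `&` B) x by []; rewrite AB.
Qed.

Lemma functional_bimeasureY A : dominated_additive nu (sigma A).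
Proof.
split; first exact: functional_bimeasure_ge0.
- move=> B B' BB'; rewrite /sigma -[X in _ = X + _]mul1r -L_lin; last 2 first.
  + exact: dominated_fun_indic2.
  + exact: dominated_fun_indic2.
  by congr L; apply/funext => z; rewrite indicU_disjoint// mulrDr mul1r.
- move=> B mB; rewrite -[leRHS]fineK ?fin_num_measure// lee_fin.
  have -> : fine (nu B) = \int[nu]_y \1_B y.
    by rewrite /Rintegral integral_indic// setIT.
  apply: L_le; first exact: dominated_fun_indic2.
    by apply: bounded_rintegrable; exact: bounded_measurable_indic.
  by move=> z; rewrite !indicE; case: (_ \in A); case: (_ \in B); rewrite ?mul1r ?mul0r.
Qed.

Lemma functional_bimeasureT A : measurable A -> (sigma A setT)%:E = mu A.
Proof.
move=> mA; rewrite -[RHS]fineK ?fin_num_measure//; congr EFin.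
have -> : fine (mu A) = \int[mu]_x \1_A x.
  by rewrite /Rintegral integral_indic// setIT.
by rewrite -L_fst//; congr L; apply/funext => z; rewrite indicT mulr1.
Qed.

(** Domination by [mu] comes from monotonicity in [B] and the first marginal. *)
Lemma functional_bimeasureX B : dominated_additive mu (sigma ^~ B).
Proof.
split; first by move=> A; exact: functional_bimeasure_ge0.
- move=> A A' AA'; rewrite /sigma -[X in _ = X + _]mul1r -L_lin; last 2 first.
  + exact: dominated_fun_indic2.
  + exact: dominated_fun_indic2.
  by congr L; apply/funext => z; rewrite indicU_disjoint// mulrDl mul1r.
- move=> A mA; rewrite -[leRHS](functional_bimeasureT mA) lee_fin.
  apply: functional_mono; [exact: dominated_fun_indic2|exact: dominated_fun_indic2|].
  by move=> z; rewrite !indicE in_setT; case: (_ \in A); case: (_ \in B);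
    rewrite ?mul1r ?mul0r.
Qed.

Lemma functional_sum n (u : 'I_n -> X * Y -> R) : (forall i, dom (u i)) ->
  L (fun z => \sum_i u i z) = \sum_i L (u i) /\ dom (fun z => \sum_i u i z).
Proof.
elim: n u => [|n IH] u du.
  rewrite big_ord0; under eq_fun do rewrite big_ord0.
  by rewrite functional0; split => //; exact: dominated_fun0.
have [IH1 IH2] := IH (fun i => u (lift ord0 i)) (fun i => du _).
have E : (fun z => \sum_(i < n.+1) u i z) =
    (fun z => 1 * u ord0 z + \sum_(i < n) u (lift ord0 i) z).
  by apply/funext => z; rewrite big_ord_recl mul1r.
rewrite E; split; last exact: dominated_fun_lin.
by rewrite L_lin// IH1 mul1r big_ord_recl.
Qed.

Context (H : X * measurableTypeR R -> Y).
Hypothesis mH : measurable_fun setT H.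
Hypothesis H_law : forall A B, measurable A -> measurable B ->
  (mu \x unit_uniform R)%E ((A `*` setT) `&` H @^-1` B) = (sigma A B)%:E.

Local Notation m := (mu \x unit_uniform R)%E.

(** [L] is not known to be continuous along monotone sequences. Equality holds for simple functions
    [f n] increasing to [g], and [L] of each is at most [L] of the limit, so monotone convergence
    gives one inequality. *)
Lemma functional_integral_le (A : set X) (g : Y -> R) : measurable A ->
  (forall y, 0 <= g y) -> rintegrable nu g ->
  (\int[m]_(z in A `*` setT) (g (H z))%:E <= (L (fun z => \1_A z.1 * g z.2))%:E)%E.
Proof.
move=> mA g0 ig; have mg : measurable_fun setT (EFin \o g) := measurable_int _ ig.
have mAT : measurable (A `*` [set: measurableTypeR R]) by exact: measurableX.
pose f := nnsfun_approx measurableT mg.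
have fg n y : f n y <= g y.
  have c := @cvg_nnsfun_approx _ _ _ _ measurableT _ mg (fun x _ => g0 x) y I.
  have nd : nondecreasing_seq (EFin \o (f ^~ y)).
    by move=> i j ij; rewrite lee_fin; apply/lefP; exact: nd_nnsfun_approx.
  have := ereal_nondecreasing_cvgn nd => /(cvg_unique _ c) => /(_ (@ereal_hausdorff _)).
  by move=> e; rewrite -lee_fin (_ : (g y)%:E = (EFin \o g) y)// e; apply: ereal_sup_ubound; exists n.
(* Both sides are the same finite combination of values of the bimeasure. *)
have fL n : (\int[m]_(z in A `*` setT) (f n (H z))%:E =
    (L (fun z => \1_A z.1 * f n z.2))%:E)%E.
  pose s := fset_set (range (f n)).
  pose B (i : 'I_#|`s|) := f n @^-1` [set s`_i].
  have mB i : measurable (B i) by exact: measurable_funPTI.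
  have mHB i : measurable (H @^-1` B i).
    by rewrite -[X in measurable X]setTI; exact: mH.
  have fE y : f n y = \sum_(i < #|`s|) s`_i * \1_(B i) y by exact: fimfunEord.
  have s0 i : 0 <= s`_i :> R.
    have [il|] := ltnP i #|`s|; last by move=> h; rewrite nth_default.
    have : s`_i \in s by exact: mem_nth.
    by rewrite in_fset_set// => /set_mem[y _ <-].
  transitivity (\int[m]_(z in A `*` setT)
      (\sum_(i < #|`s|) (s`_i)%:E * (\1_(H @^-1` B i) z)%:E))%E.
    apply: eq_integral => z _; rewrite fE -sumEFin.
    by apply: eq_bigr => i _; rewrite EFinM.
  rewrite ge0_integral_sum//; last 2 first.
  - move=> i; apply: measurable_funeM; apply/measurable_EFinP.
    by apply: measurable_funTS; exact: measurable_indic.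
  - by move=> i z _; rewrite lee_fin mulr_ge0.
  have [E1 _] := @functional_sum #|`s|
    (fun i z => s`_i * (\1_A z.1 * \1_(B i) z.2) + 0)
    (fun i => dominated_fun_lin _ (dominated_fun_indic2 A (B i)) dominated_fun0).
  transitivity (L (fun z => \sum_(i < #|`s|) (s`_i * (\1_A z.1 * \1_(B i) z.2) + 0)))%:E.
    rewrite E1 -sumEFin; apply: eq_bigr => i _.
    rewrite (L_lin _ (dominated_fun_indic2 A (B i)) dominated_fun0) functional0 addr0.
    rewrite ge0_integralZl//; last 2 first.
    - apply/measurable_EFinP; apply: measurable_funTS; exact: measurable_indic.
    - by rewrite lee_fin.
    have e := H_law mA (mB i).
    by rewrite integral_indic// EFinM; congr (_ * _)%E; rewrite setIC; exact: e.
  congr EFin; congr L; apply/funext => z; rewrite fE mulr_sumr.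
  by apply: eq_bigr => i _; rewrite addr0; ring.
have fcvg y : (fun n => (f n y)%:E) @ \oo --> (g y)%:E.
  exact: (@cvg_nnsfun_approx _ _ _ _ measurableT _ mg (fun x _ => g0 x) y I).
have -> : (\int[m]_(z in A `*` setT) (g (H z))%:E =
    \int[m]_(z in A `*` setT) limn (fun n => (f n (H z))%:E))%E.
  by apply: eq_integral => z _; apply/esym/cvg_lim.
rewrite (monotone_convergence _ mAT (g' := fun n z => (f n (H z))%:E)); last 3 first.
- move=> n; apply/measurable_EFinP; apply: measurable_funTS.
  by apply: measurableT_comp.
- by move=> n z _; rewrite lee_fin.
- by move=> z _ i j ij; rewrite lee_fin; apply/lefP; exact: nd_nnsfun_approx.
under eq_fun do rewrite fL.
have df n : dom (fun z => \1_A z.1 * f n z.2).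
  apply: dominated_fun_indicM; apply: le_integrable ig => //.
    by apply/measurable_EFinP; exact: measurable_funPT.
  by move=> y _ /=; rewrite lee_fin !ger0_norm.
apply: lime_le; last first.
  apply: nearW => n; rewrite lee_fin; apply: functional_mono => //.
  - exact: dominated_fun_indicM.
  - by move=> z; rewrite ler_wpM2l.
apply: ereal_nondecreasing_is_cvgn => i j ij; rewrite lee_fin.
apply: functional_mono => // z; rewrite ler_wpM2l//.
by apply/lefP; exact: nd_nnsfun_approx.
Qed.

Lemma functional_law (g : Y -> \bar R) : measurable_fun setT g ->
  (forall y, 0 <= g y)%E -> (\int[m]_z g (H z) = \int[nu]_y g y)%E.
Proof.
move=> mg g0.
have -> : (\int[nu]_y g y = \int[pushforward m H]_y g y)%E.
  apply: eq_measure_integral => B mB _.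
  have e := H_law measurableT mB; rewrite setXTT setTI in e.
  apply: (etrans _ (esym e)); rewrite /sigma.
  rewrite (_ : (fun z => _) = (fun z => \1_B z.2)); last first.
    by apply/funext => z; rewrite indicT mul1r.
  rewrite functional_snd; last first.
    by apply: bounded_rintegrable; exact: bounded_measurable_indic.
  by rewrite /Rintegral integral_indic// setIT fineK// fin_num_measure.
rewrite (ge0_integral_pushforward mH)//.
Qed.

(** The inequality holds for [A] and for its complement, while both sides have the same finite
    total, the integral of [g]; so neither can be strict. *)
Lemma functional_integral_ge0 (A : set X) (g : Y -> R) : measurable A ->
  (forall y, 0 <= g y) -> rintegrable nu g ->
  (\int[m]_(z in A `*` setT) (g (H z))%:E = (L (fun z => \1_A z.1 * g z.2))%:E)%E.
Proof.
move=> mA g0 ig; have mg : measurable_fun setT (EFin \o g) := measurable_int _ ig.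
have mAc : measurable (~` A) by exact: measurableC.
have leA := functional_integral_le mA g0 ig.
have leAc := functional_integral_le mAc g0 ig.
have E1 : (\int[m]_(z in A `*` setT) (g (H z))%:E +
    \int[m]_(z in ~` A `*` setT) (g (H z))%:E = \int[nu]_y (g y)%:E)%E.
  rewrite -ge0_integral_setU//.
  - rewrite (_ : A `*` setT `|` ~` A `*` setT = setT).
      by apply: (functional_law mg) => y; rewrite lee_fin.
    by apply/seteqP; split => // z _; have [Az|nAz] := pselect (A z.1); [left|right].
  - exact: measurableX.
  - exact: measurableX.
  - by apply: measurable_funTS; exact: measurableT_comp mg mH.
  - by move=> z _; rewrite lee_fin.
  - by apply/disj_setPS => z [[Az _] [nAz _]].
have E2 : ((L (fun z => \1_A z.1 * g z.2))%:E + (L (fun z => \1_(~` A) z.1 * g z.2))%:E =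
    \int[nu]_y (g y)%:E)%E.
  rewrite -EFinD -[X in (X + _)%R]mul1r -L_lin; last 2 first.
  - exact: dominated_fun_indicM.
  - exact: dominated_fun_indicM.
  rewrite (_ : (fun z => _) = (fun z => g z.2)); last first.
    apply/funext => z; rewrite !indicE in_setC; case: (_ \in A) => /=; lra.
  by rewrite functional_snd// /Rintegral fineK//; apply: integrable_fin_num.
apply/eqP; rewrite eq_le leA/= leNgt; apply/negP => lt.
have : (\int[nu]_y (g y)%:E < \int[nu]_y (g y)%:E)%E.
  rewrite -[X in (X < _)%E]E1 -E2; apply: lte_leD => //.
  rewrite ge0_fin_numE; first exact: le_lt_trans leAc (ltry _).
  by apply: integral_ge0 => z _; rewrite lee_fin.
by rewrite ltxx.
Qed.

Lemma functional_integral (A : set X) (g : Y -> R) : measurable A ->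
  rintegrable nu g ->
  (\int[mu]_(x in A) \int[unit_uniform R]_u (g (H (x, u)))%:E =
   (L (fun z => \1_A z.1 * g z.2))%:E)%E.
Proof.
move=> mA ig; have mg : measurable_fun setT (EFin \o g) := measurable_int _ ig.
have mg' : measurable_fun setT g by exact/measurable_EFinP.
have mgH : measurable_fun setT (fun z => (g (H z))%:E) by exact: measurableT_comp mg mH.
have mAT : measurable (A `*` [set: measurableTypeR R]) by exact: measurableX.
have igH : m.-integrable setT (fun z => (g (H z))%:E).
  apply/integrableP; split => //.
  rewrite (functional_law (g := fun y => `|(g y)%:E|%E))//.
    by have /integrableP[] := ig.
  exact: measurableT_comp.
have ip : rintegrable nu g^\+.
  apply: le_integrable ig => //.
    by apply/measurable_EFinP; exact: measurable_funrpos.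
  by move=> y _ /=; rewrite lee_fin (ger0_norm (funrpos_ge0 _ _)) /funrpos ge_max ler_norm normr_ge0.
have im : rintegrable nu g^\-.
  apply: le_integrable ig => //.
    by apply/measurable_EFinP; exact: measurable_funrneg.
  by move=> y _ /=; rewrite lee_fin (ger0_norm (funrneg_ge0 _ _)) /funrneg ge_max -normrN ler_norm normr_ge0.
transitivity (\int[m]_(z in A `*` setT) (g (H z))%:E)%E.
  rewrite integral_mkcond [RHS]integral_mkcond -integral12_prod_meas1; last first.
    by rewrite -integrable_mkcond//; exact: integrableS igH.
  apply: eq_integral => x _; rewrite /fubini_F patchE.
  case: ifPn => [Ax|nAx].
    by apply: eq_integral => u _; rewrite patchE in_setX Ax in_setT.
  rewrite integral0_eq// => u _; rewrite patchE in_setX (negbTE nAx)//.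
rewrite integralE.
have -> : (\int[m]_(z in A `*` setT) (fun z => (g (H z))%:E)^\+ z =
   \int[m]_(z in A `*` setT) (g^\+ (H z))%:E)%E.
  by apply: eq_integral => z _; rewrite funeposE -EFin_max.
have -> : (\int[m]_(z in A `*` setT) (fun z => (g (H z))%:E)^\- z =
   \int[m]_(z in A `*` setT) (g^\- (H z))%:E)%E.
  by apply: eq_integral => z _; rewrite funenegE -EFinN -EFin_max.
rewrite !functional_integral_ge0// -EFinB; congr EFin.
rewrite addrC -mulN1r -L_lin; last 2 first.
- exact: dominated_fun_indicM.
- exact: dominated_fun_indicM.
congr L; apply/funext => z; rewrite -[in RHS](funrposBneg g) /= !fctE; ring.
Qed.

End functional_bimeasure.

Section coupling_kernel.
Context dX (X : measurableType dX) dY (Y : measurableType dY) (R : realType).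
Context (mu : probability X R) (nu : probability Y R) (n : nat).
Context (T : X -> 'I_n -> R) (F : Y -> 'I_n -> R).
Hypothesis iT : forall i, rintegrable mu (T ^~ i).
Hypothesis iF : forall i, rintegrable nu (F ^~ i).
Hypothesis affine_le : forall (a : X -> R) (b : 'I_n -> X -> R) (psi : Y -> R),
  bounded_measurable a -> (forall i, bounded_measurable (b i)) ->
  rintegrable nu psi ->
  (forall x y, a x + \sum_i b i x * F y i <= psi y) ->
  \int[mu]_x (a x + \sum_i b i x * T x i) <= \int[nu]_y psi y.
Context (s : Y -> R) (q : R -> Y) (D : set Y).
Hypothesis ms : measurable_fun setT s.
Hypothesis mq : measurable_fun setT q.
Hypothesis s01 : forall y, 0 <= s y <= 1.
Hypothesis mD : measurable D.
Hypothesis nuD : nu D = 1%E.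
Hypothesis sqD : forall y, D y -> q (s y) = y.

(** The complement of [D] is null for [nu], hence for [m]. This lets [q (s y)] be identified with
    [y] under [sigma A]. *)
Lemma dominated_additive_support (m : set Y -> R) B :
  dominated_additive nu m -> m (B `&` D) = m B.
Proof.
move=> [ge0 add le].
have mono A A' : A `<=` A' -> m A <= m A'.
  move=> AA'; rewrite -(setDUK AA') add ?setDIK// lerDl; exact: ge0.
have D0 : m (~` D) = 0.
  apply/eqP; rewrite eq_le ge0 andbT -lee_fin.
  have := le _ (measurableC mD); rewrite -[leRHS]/(nu (~` D)).
  by rewrite probability_setC// nuD subee.
rewrite -[in RHS](setUIDK B D) add; last first.
  by apply/seteqP; split => // y [[_ Dy] [_ nDy]].
rewrite [X in _ + X](_ : _ = 0) ?addr0//.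
apply/eqP; rewrite eq_le ge0 andbT -D0; apply: mono => y [].
by [].
Qed.

Lemma coupling_kernel : exists H : X * measurableTypeR R -> Y,
  [/\ measurable_fun setT H,
      forall g : Y -> \bar R, measurable_fun setT g -> (forall y, 0 <= g y)%E ->
        (\int[mu \x unit_uniform R]_z g (H z) = \int[nu]_y g y)%E
    & forall i, {ae mu, forall x,
        (T x i)%:E = (\int[unit_uniform R]_u (F (H (x, u)) i)%:E)%E}].
Proof.
have [L [L_lin L_le L_aff]] := coupling_functional iT iF affine_le.
have b0 : bounded_measurable ((fun=> 0) : X -> R) by exact: bounded_measurable_cst.
have L_fst A : measurable A -> L (fun z => \1_A z.1) = \int[mu]_x \1_A x.
  move=> mA; have bA : bounded_measurable (\1_A : X -> R).
    exact: bounded_measurable_indic.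
  have := L_aff \1_A (fun _ _ => 0) bA (fun i => b0).
  rewrite (_ : (fun z => _) = (fun z => \1_A z.1)); last first.
    by apply/funext => z; rewrite big1 ?addr0// => i _; rewrite mul0r.
  by move=> ->; apply: eq_Rintegral => x _;
    rewrite big1 ?addr0// => i _; rewrite mul0r.
have sigmaX := functional_bimeasureX L_lin L_le L_fst.
have sigmaY := functional_bimeasureY L_lin L_le.
have sigmaT := functional_bimeasureT L_fst.
have [Q [mQ HQ]] := quantile_function sigmaX sigmaY sigmaT ms s01.
pose H z := q (Q z).
have mH : measurable_fun setT H by exact: measurableT_comp.
have H_law A B : measurable A -> measurable B ->
    (mu \x unit_uniform R)%E ((A `*` setT) `&` H @^-1` B) =
    (functional_bimeasure L A B)%:E.
  move=> mA mB; have mqB : measurable (q @^-1` B).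
    by rewrite -[X in measurable X]setTI; exact: mq.
  rewrite (HQ A _ mA mqB); congr EFin.
  (* The quantile map gives the mass of the [y] with [q (s y)] in [B]; within [D] these are the
     points of [B]. *)
  rewrite -(dominated_additive_support _ (sigmaY A)).
  rewrite -[RHS](dominated_additive_support _ (sigmaY A)).
  congr (functional_bimeasure L A _); apply/seteqP.
  by split => y [By Dy]; split => //; move: By; rewrite /= sqD.
exists H; split => //.
  by move=> g mg g0; exact: (functional_law L_lin L_le mH H_law).
move=> i; have int_eq := functional_integral L_lin L_le mH H_law.
suff : ae_eq mu setT (EFin \o T ^~ i)
    (fun x => \int[unit_uniform R]_u (F (H (x, u)) i)%:E)%E.
  by apply: filterS => x; exact.
apply: (integral_ae_eq measurableT (iT i)).
  apply: (@measurable_fubini_F _ _ _ _ _ _ _ (fun z => (F (H z) i)%:E)).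
  apply/integrableP; split.
    exact: (measurableT_comp (measurable_int _ (iF i)) mH).
  have /integrableP[mFi Fioo] := iF i.
  have mFi' := measurableT_comp (@abse_measurable R setT) mFi.
  have e := functional_law L_lin L_le mH H_law mFi' (fun y => abse_ge0 _).
  by apply: le_lt_trans Fioo; rewrite -e.
move=> E _ mE; rewrite (int_eq E (F ^~ i) mE (iF i)).
(* Coordinate [i] over [E] is singled out by taking the indicator of [E] as [i]-th coefficient and
   zero for the others. *)
have := L_aff (fun=> 0) (fun j => if j == i then \1_E else fun=> 0)
  b0.
have -> : (fun z : X * Y => 0 + \sum_j (if j == i then \1_E else fun=> 0) z.1 * F z.2 j) =
    (fun z => \1_E z.1 * F z.2 i).
  apply/funext => z; rewrite add0r (bigD1 i)//= eqxx big1 ?addr0// => j /negbTE ->.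
  by rewrite mul0r.
move=> ->; last first.
  move=> j; case: eqP => _; first exact: bounded_measurable_indic.
  exact: bounded_measurable_cst.
have -> : (fun x => 0 + \sum_j (if j == i then \1_E else fun=> 0) x * T x j) =
    (fun x => \1_E x * T x i).
  apply/funext => z; rewrite add0r (bigD1 i)//= eqxx big1 ?addr0// => j /negbTE ->.
  by rewrite mul0r.
rewrite /Rintegral fineK; last first.
  apply: integrable_fin_num => //.
  by apply: bounded_measurableM => //; exact: bounded_measurable_indic.
rewrite integral_mkcond; apply: eq_integral => x _; rewrite patchE /= indicE.
by case: ifPn => _ /=; rewrite ?mul1r ?mul0r.
Qed.

End coupling_kernel.

(** * Convex functions and laws on row vectors *)

Section row_vectors.
Context (R : realType) (d : nat).

Lemma ler_coord_norm (v : 'rV[R]_d) i : `|v ord0 i| <= `|v|.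
Proof.
rewrite [leRHS]mx_normrE.
exact: (@le_bigmax _ _ _ (0 : R) (fun ij : 'I_1 * 'I_d => `|v ij.1 ij.2|) (ord0, i)).
Qed.

Lemma ler_norm_sum_coord (v : 'rV[R]_d) : `|v| <= \sum_i `|v ord0 i|.
Proof.
rewrite [leLHS]mx_normrE; apply: bigmax_le; first exact: sumr_ge0.
move=> [i j] _ /=; rewrite (bigD1 j)//= ord1 lerDl; exact: sumr_ge0.
Qed.

Lemma continuous_measurable_borel (Z : ptopologicalType) (g : Z -> R) :
  continuous g -> measurable_fun setT (g : borel Z -> R).
Proof.
move=> cg; apply: (measurability _ (RGenInftyO.measurableE R)) => _ [_ [t ->] <-].
rewrite setTI; apply: open_measurable_borel.
by apply: open_comp => [x _|]; [exact: cg|exact: interval_open].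
Qed.

Lemma measurable_coord i :
  measurable_fun setT ((fun v => v ord0 i) : borel 'rV[R]_d -> R).
Proof.
by apply: continuous_measurable_borel; exact: coord_continuous.
Qed.

(* Every open set is the union of the rational cubes that it contains. *)
Lemma measurable_row dX (X : measurableType dX) (f : X -> 'rV[R]_d) :
  (forall i, measurable_fun setT (fun x => f x ord0 i)) ->
  measurable_fun setT (f : X -> borel 'rV[R]_d).
Proof.
move=> mf; apply: measurable_fun_generated => U oU.
pose cube (z : 'rV[rat]_d * nat) : set 'rV[R]_d :=
  [set v | forall i, `|v ord0 i - ratr (z.1 ord0 i)| < z.2.+1%:R^-1].
have mcube z : measurable (f @^-1` cube z).
  rewrite (_ : _ @^-1` _ = \bigcap_(i in [set: 'I_d])
    ((fun x => `|f x ord0 i - ratr (z.1 ord0 i)|) @^-1` `]-oo, z.2.+1%:R^-1[%classic)).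
    apply: fin_bigcap_measurable; first exact: finite_finset.
    move=> i _; rewrite -[X in measurable X]setTI.
    apply: (measurableT_comp (@normr_measurable R setT)) => //.
    exact: measurable_funB.
  apply/seteqP; split => x /=.
    by move=> h i _; rewrite /= in_itv/=; exact: h.
  by move=> h i; have := h i I; rewrite /= in_itv.
rewrite (_ : f @^-1` U = \bigcup_(z : 'rV[rat]_d * nat)
  (if pselect (cube z `<=` U) then f @^-1` cube z else set0)).
  apply: countable_bigcupT_measurable; first exact: countableP.
  by move=> z; case: (pselect (cube z `<=` U)) => h; [exact: mcube|exact: measurable0].
apply/seteqP; split => x; last first.
  by move=> [z _]; case: pselect => // zU /zU.
move=> /= Ufx.
have /nbhs_ballP[e /= e0 eU] : nbhs (f x) U by exact: open_nbhs_nbhs.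
have e20 : 0 < e / 2 by rewrite divr_gt0.
have [n _ /(_ n (leqnn n)) /= ne] := near_infty_natSinv_lt (PosNum e20).
have n0 : 0 < n.+1%:R^-1 :> R by rewrite invr_gt0.
have /choice[r rx] i : exists r : rat, `|f x ord0 i - ratr r| < n.+1%:R^-1.
  have [r] := @rat_in_itvoo R (f x ord0 i) (f x ord0 i + n.+1%:R^-1) ltac:(by rewrite ltrDl).
  rewrite in_itv/= => /andP[xr rx]; exists r.
  by rewrite distrC ger0_norm ?subr_ge0 1?ltW// ltrBlDl.
exists (\row_i r i, n) => //; case: pselect => /= [_ i|]; first by rewrite mxE.
case=> v /= vz; apply: eU; split => // i j; rewrite !ord1.
rewrite /ball /= -(subrK (ratr (r j)) (f x ord0 j)) -addrA.
have := vz j; rewrite mxE distrC => vj.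
rewrite (le_lt_trans (ler_normD _ _))// [e]splitr.
by rewrite ltrD// (lt_trans _ ne).
Qed.

Lemma convex_functionP (phi : 'rV[R]_d -> R) :
  convex_function [set: convex_lmodType 'rV[R]_d] phi <->
  forall u v t, 0 <= t <= 1 ->
    phi (t *: u + (1 - t) *: v) <= t * phi u + (1 - t) * phi v.
Proof.
split=> [cphi u v t /andP[t0 t1]|H t u v _ _].
  by have := cphi (Itv01 t0 t1) u v (mem_set I) (mem_set I).
by apply: H; apply/andP; split.
Qed.

(* The subgradient is a linear functional below [v |-> inf_s (phi (t + s v) -
   phi t) / s], obtained from Hahn-Banach. *)
Lemma convex_subgradient (phi : 'rV[R]_d -> R) (t : 'rV[R]_d) :
  convex_function [set: convex_lmodType 'rV[R]_d] phi ->
  exists c : 'I_d -> R, forall v : 'rV[R]_d,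
    phi t + \sum_i c i * (v ord0 i - t ord0 i) <= phi v.
Proof.
move=> /convex_functionP cphi.
pose S v := [set r | exists s, 0 < s /\ r = (phi (t + s *: v) - phi t) / s].
(* Convexity at [t], the combination of [t + s v] and [t - v] with weights [1 / (1 + s)] and
   [s / (1 + s)], bounds the difference quotients from below. *)
have lbS v : lbound (S v) (phi t - phi (t - v)).
  move=> _ [s [s0 ->]]; rewrite ler_pdivlMr//.
  have s1 : 0 < 1 + s by lra.
  have := cphi (t + s *: v) (t - v) (1 + s)^-1.
  have -> : (1 + s)^-1 *: (t + s *: v) + (1 - (1 + s)^-1) *: (t - v) = t.
    apply/rowP => i; rewrite !mxE; field; lra.
  have h : 0 <= (1 + s)^-1 <= 1.
    by rewrite invr_ge0 ltW//= invf_le1//; lra.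
  move=> /(_ h) /(ler_wpM2l (ltW s1)); rewrite mulrDr !mulrA mulrBr.
  rewrite divff ?lt0r_neq0//; lra.
have neS v : S v !=set0 by exists ((phi (t + 1 *: v) - phi t) / 1), 1.
have hlb v : has_lbound (S v) by exists (phi t - phi (t - v)); exact: lbS.
pose p v := inf (S v).
have p_le v s : 0 < s -> p v <= (phi (t + s *: v) - phi t) / s.
  by move=> s0; apply: ge_inf => //; exists s.
have p_add u v : [set: 'rV[R]_d] u -> [set: 'rV[R]_d] v -> p (u + v) <= p u + p v.
  move=> _ _; rewrite -lerBlDr; apply: lb_le_inf => // _ [s [s0 ->]].
  rewrite lerBlDr -lerBlDl; apply: lb_le_inf => // _ [r [r0 ->]].
  rewrite lerBlDl.
  have sr0 : 0 < s + r by lra.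
  (* With this step [k], [t + k (u + v)] is the convex combination of [t + s u] and [t + r v] with
     weights [r / (s + r)] and [s / (s + r)]. *)
  have k0 : 0 < s * r / (s + r) by rewrite divr_gt0// mulr_gt0.
  apply: (le_trans (p_le _ _ k0)); rewrite ler_pdivrMr//.
  have := cphi (t + s *: u) (t + r *: v) (r / (s + r)).
  have -> : (r / (s + r)) *: (t + s *: u) + (1 - r / (s + r)) *: (t + r *: v) =
      t + (s * r / (s + r)) *: (u + v).
    apply/rowP => i; rewrite !mxE; field; lra.
  have h : 0 <= r / (s + r) <= 1.
    by apply/andP; split; [rewrite divr_ge0// ltW|rewrite ler_pdivrMr// mul1r; lra].
  move=> /(_ h) h'.
  have -> : ((phi (t + s *: u) - phi t) / s + (phi (t + r *: v) - phi t) / r) *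
      (s * r / (s + r)) = r / (s + r) * phi (t + s *: u) +
      (1 - r / (s + r)) * phi (t + r *: v) - phi t.
    by field; rewrite !lt0r_neq0.
  by rewrite lerD2r.
have p_scale k u : 0 < k -> [set: 'rV[R]_d] u -> p (k *: u) <= k * p u.
  move=> k0 _; rewrite -ler_pdivrMl//; apply: lb_le_inf => // _ [s [s0 ->]].
  rewrite ler_pdivrMl//; apply: (le_trans (p_le _ _ (divr_gt0 s0 k0))).
  rewrite scalerA divfK ?lt0r_neq0// invf_div mulrCA mulrC -!mulrA.
  by rewrite le_eqVlt; apply/orP; left; apply/eqP; ring.
have p0 : p 0 = 0.
  apply/eqP; rewrite eq_le; apply/andP; split.
    by apply: (le_trans (p_le 0 1 ltr01)); rewrite scaler0 addr0 subrr mul0r.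
  by apply: lb_le_inf => // _ [s [s0 ->]]; rewrite scaler0 addr0 subrr mul0r.
have G0d : dominated_graph setT p [set (0, 0)].
  split => //.
    by move=> k u v r s [-> ->] [-> ->]; rewrite scaler0 mulr0 !addr0.
  by move=> u r [-> ->]; rewrite p0.
have [L [Llin Lp _]] := hahn_banach (fun _ _ _ _ _ => I) p_add p_scale G0d.
have L0 : L 0 = 0.
  have := Llin (-1) 0 0 I I; rewrite scaler0 addr0; lra.
have Lsum v : L v = \sum_i v ord0 i * L (delta_mx ord0 i).
  rewrite [in LHS](row_sum_delta v).
  apply: (big_ind2 (fun x y => L x = y)) => // [x1 y1 x2 y2 <- <-|i _].
    by have := Llin 1 x1 x2 I I; rewrite scale1r mul1r.
  by have := Llin (v ord0 i) (delta_mx ord0 i) 0 I I; rewrite L0 !addr0.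
exists (fun i => L (delta_mx ord0 i)) => v.
have := le_trans (Lp (v - t) I) (p_le (v - t) 1 ltr01).
rewrite scale1r divr1 (addrC t) subrK Lsum lerBrDr.
rewrite addrC; congr (_ + _ <= _); apply: eq_bigr => i _.
by rewrite !mxE mulrC.
Qed.

End row_vectors.

Lemma affine_continuous (R : realType) (d : nat) (a : R) (b : 'I_d -> R) :
  continuous (fun v : 'rV[R]_d => a + \sum_i b i * v ord0 i).
Proof.
move=> v.
have FF : Filter (nbhs (v : 'rV[R]_d)) := nbhs_filter (v : 'rV[R]_d).
have h1 : (cst a : 'rV[R]_d -> R) @ v --> a by apply: cvg_cst.
have h2 : (fun w : 'rV[R]_d => \sum_i b i * w ord0 i) @ v -->
    \sum_i b i * v ord0 i.
  apply: cvg_big => [|i _]; first exact: add_continuous.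
  by apply: cvgMr; exact: coord_continuous.
exact: cvgD h1 h2.
Qed.

Section laws.
Context dO (O : measurableType dO) (R : realType) (P : probability O R).

Lemma integrable_distribution dV (V : measurableType dV) (X : {mfun O >-> V})
    (g : V -> R) : measurable_fun setT g ->
  rintegrable (distribution P X) g <-> rintegrable P (g \o X).
Proof.
move=> mg; have mG : measurable_fun setT (EFin \o g) by exact/measurable_EFinP.
have mgX : measurable_fun setT (EFin \o (g \o X)).
  by apply/measurable_EFinP; exact: measurableT_comp.
have mabs : measurable_fun setT (fun v => `|(g v)%:E|%E).
  exact: (measurableT_comp (@abse_measurable R setT)).
have e := @ge0_integral_distribution _ _ _ _ _ P X (fun v => `|(g v)%:E|%E) mabs
  (fun v => abse_ge0 _).
split=> /integrableP[_ oo]; apply/integrableP; split => //.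
  by move: oo; rewrite e.
by rewrite e.
Qed.

Lemma integral_distribution_rintegrable dV (V : measurableType dV) (X : {mfun O >-> V})
    (g : V -> R) : measurable_fun setT g -> rintegrable P (g \o X) ->
  (\int[distribution P X]_v (g v)%:E = \int[P]_x (g (X x))%:E)%E.
Proof.
move=> mg ig; apply: integral_distribution => //.
exact/measurable_EFinP.
Qed.

Lemma rintegrable_le (f g : O -> R) : measurable_fun setT f -> rintegrable P g ->
  (forall x, `|f x| <= g x) -> rintegrable P f.
Proof.
move=> mf ig fg; apply: le_integrable ig => //; first exact/measurable_EFinP.
by move=> x _ /=; rewrite lee_fin (le_trans (fg x))// ler_norm.
Qed.

Context (d : nat) (X : {mfun O >-> borel 'rV[R]_d}).

Lemma measurable_mfun_coord i : measurable_fun setT (fun x => X x ord0 i).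
Proof.
exact: (measurableT_comp (@measurable_coord R d i) (measurable_funPT X)).
Qed.

Lemma finite_first_momentP : finite_first_moment (distribution P X) <->
  forall i, rintegrable P (fun x => X x ord0 i).
Proof.
have mn : measurable_fun setT ((fun v => `|v|) : borel 'rV[R]_d -> R).
  by apply: continuous_measurable_borel; exact: norm_continuous.
have := integrable_distribution X mn; rewrite /finite_first_moment /rintegrable => ->.
split=> [iX i|iX].
  apply: (rintegrable_le (measurable_mfun_coord i) iX) => x.
  exact: ler_coord_norm.
apply: (rintegrable_le (g := fun x => \sum_i `|X x ord0 i|)).
- exact: measurableT_comp mn (measurable_funPT X).
- by apply: rintegrable_sum => i; exact: integrable_abse (iX i).
- by move=> x /=; rewrite normr_id; exact: ler_norm_sum_coord.
Qed.

End laws.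

Section affine_le.
Context dX (X : measurableType dX) dY (Y : measurableType dY) (R : realType).
Context (mu : probability X R) (nu : probability Y R) (d : nat).
Context (T : {mfun X >-> borel 'rV[R]_d}) (F : {mfun Y >-> borel 'rV[R]_d}).
Hypothesis TF : convex_order (distribution mu T) (distribution nu F).

(** With [phi v] the supremum over [x] of [l x v], the chain is [l x (T x) <= phi (T x)], then the
    convex order for [phi], then [phi (F y) <= psi y]. Boundedness of [a] and [b] bounds [phi] by
    [B], which is integrable for both laws. *)
Lemma convex_order_affine_le (a : X -> R) (b : 'I_d -> X -> R) (psi : Y -> R) :
  bounded_measurable a -> (forall i, bounded_measurable (b i)) ->
  rintegrable nu psi ->
  (forall x y, a x + \sum_i b i x * F y ord0 i <= psi y) ->
  \int[mu]_x (a x + \sum_i b i x * T x ord0 i) <= \int[nu]_y psi y.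
Proof.
have [/finite_first_momentP iT /finite_first_momentP iF cTF] := TF.
move=> ba bb ipsi le_psi.
have [ma [M aM]] := ba.
have /choice[N bN] i : exists N, forall x, `|b i x| <= N by have [_] := bb i.
pose l x (v : 'rV[R]_d) := a x + \sum_i b i x * v ord0 i.
pose B (v : 'rV[R]_d) := M + \sum_i N i * `|v ord0 i|.
have lB x v : `|l x v| <= B v.
  rewrite (le_trans (ler_normD _ _))// lerD//.
  rewrite (le_trans (ler_norm_sum _ _ _))// ler_sum// => i _.
  by rewrite normrM ler_wpM2r.
pose S v := range (l ^~ v).
have hubS v : has_ubound (S v).
  by exists (B v) => _ [x _ <-]; rewrite (le_trans (ler_norm _)).
have hsS v : has_sup (S v) by split => //; exists (l point v), point.
pose phi v := sup (S v).
have l_phi x v : l x v <= phi v by apply: ub_le_sup => //; exists x.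
have phi_le v r : (forall x, l x v <= r) -> phi v <= r.
  by move=> H; apply: ge_sup => [|_ [x _ <-]//]; exists (l point v), point.
have phiB v : `|phi v| <= B v.
  rewrite ler_norml; apply/andP; split; last first.
    by apply: phi_le => x; rewrite (le_trans (ler_norm _)).
  apply: le_trans (l_phi point v); have := lB point v.
  by rewrite ler_norml => /andP[].
have cphi : convex_function [set: convex_lmodType 'rV[R]_d] phi.
  apply/convex_functionP => u v t /andP[t0 t1]; apply: phi_le => x.
  have -> : l x (t *: u + (1 - t) *: v) = t * l x u + (1 - t) * l x v.
    rewrite /l !mulrDr addrACA -mulrDl (addrC t (1 - t)) subrK mul1r !mulr_sumr -big_split/=.
    by congr (_ + _); apply: eq_bigr => i _; rewrite !mxE; ring.
  by apply: lerD; apply: ler_wpM2l => //; rewrite subr_ge0.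
have cl x : continuous (l x).
  exact: affine_continuous.
(* The supremum may be uncountable, but it is lower semicontinuous: its superlevel sets are unions
   of open half-spaces or trivial sets. *)
have mphi : measurable_fun setT (phi : borel 'rV[R]_d -> R).
  apply: (measurability _ (RGenOInfty.measurableE R)) => _ [_ [t ->] <-].
  rewrite setTI; apply: open_measurable_borel.
  have -> : phi @^-1` `]t, +oo[%classic = \bigcup_x (l x @^-1` `]t, +oo[%classic).
    apply/seteqP; split => v /=.
      rewrite in_itv/= andbT => /(sup_gt (hsS v).1)[_ [x _ <-] tl].
      by exists x => //=; rewrite in_itv/= andbT.
    move=> [x _]; rewrite /= !in_itv/= !andbT => /lt_le_trans; apply.
    exact: l_phi.
  apply: bigcup_open => x _; apply: open_comp; last exact: interval_open.
  by move=> v _; exact: cl.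
have iB dO (O : measurableType dO) (P : probability O R) (Z : {mfun O >-> borel 'rV[R]_d}) :
    (forall i, rintegrable P (fun x => Z x ord0 i)) -> rintegrable P (B \o Z).
  move=> iZ; have := @rintegrable_lin _ _ _ P 1 (fun=> M) (fun x => \sum_i N i * `|Z x ord0 i|).
  rewrite (_ : (fun x => 1 * M + _) = B \o Z); last first.
    by apply/funext => x /=; rewrite mul1r.
  apply; first exact: rintegrable_cst.
  apply: rintegrable_sum => i.
  have := @rintegrable_lin _ _ _ P (N i) (fun x => `|Z x ord0 i|) (fun=> 0).
  rewrite (_ : (fun x => _ + 0) = (fun x => N i * `|Z x ord0 i|)); last first.
    by apply/funext => x /=; rewrite addr0.
  apply; last exact: rintegrable0.
  exact: integrable_abse (iZ i).
have iphi dO (O : measurableType dO) (P : probability O R) (Z : {mfun O >-> borel 'rV[R]_d}) :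
    (forall i, rintegrable P (fun x => Z x ord0 i)) -> rintegrable P (phi \o Z).
  move=> iZ; apply: (rintegrable_le _ (iB _ _ _ _ iZ)) => [|x]; last exact: phiB.
  exact: measurableT_comp mphi (measurable_funPT Z).
have iphiF := iphi _ _ nu F iF.
have iphiT := iphi _ _ mu T iT.
have := cTF phi cphi ((integrable_distribution nu F mphi).2 iphiF).
rewrite !integral_distribution_rintegrable// => phiTF.
have ml : measurable_fun setT (fun x => l x (T x)).
  apply: measurable_funD => //; apply: measurable_sum => i.
  by apply: measurable_funM; [have [] := bb i|exact: measurable_mfun_coord].
apply: (@le_trans _ _ (\int[mu]_x phi (T x))).
  apply: le_Rintegral; [by []| |exact: iphiT|by move=> x _; exact: l_phi].
  by apply: (rintegrable_le ml (iB _ _ mu T iT)) => x; exact: lB.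
apply: (@le_trans _ _ (\int[nu]_y phi (F y))).
  by rewrite -lee_fin /Rintegral !fineK//; apply: integrable_fin_num.
apply: le_Rintegral; [by []|exact: iphiF|exact: ipsi|].
by move=> y _; apply: phi_le => x; exact: le_psi.
Qed.

End affine_le.

(** * Integrals and measurability up to null sets *)

Section ae_nonmeasurable.
Import HBNNSimple.
Context d (T : measurableType d) (R : realType) (mu : {measure set T -> \bar R}).
Implicit Types f g : T -> \bar R.

(* Restricting a simple function below [f] to the complement of the null set
   gives a simple function below [g] with the same integral. *)
Lemma le_integral_ae_nonneg f g : (forall x, 0 <= f x)%E ->
  (forall x, 0 <= g x)%E -> {ae mu, forall x, f x = g x} ->
  (\int[mu]_x f x <= \int[mu]_x g x)%E.
Proof.
move=> f0 g0 [N [mN N0 NP]].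
have fg x : ~ N x -> f x = g x by move=> Nx; apply: contrapT => /NP.
rewrite [leLHS]ge0_integralTE// [leRHS]ge0_integralTE//.
apply: ge_ereal_sup => _ [h /= hf <-].
have mNc : measurable (~` N) by exact: measurableC.
pose h' := proj_nnsfun h mNc.
apply: ereal_sup_ubound; exists h' => /=.
  move=> x; rewrite -[leLHS]/((h x * \1_(~` N) x)%:E) indicE; case: (boolP (x \in _)) => [/set_mem nNx|_].
    by rewrite mulr1 -fg.
  by rewrite mulr0.
have sE (k : {nnsfun T >-> R}) : sintegral mu k = (\int[mu]_x (k x)%:E)%E.
  by rewrite integral_nnsfun// patch_setT.
rewrite !sE; apply: ae_eq_integral => //.
- by apply/measurable_EFinP.
- by apply/measurable_EFinP.
exists N; split => // x /= H; apply: contrapT => nNx; apply: H => _.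
by rewrite -[LHS]/((h x * \1_(~` N) x)%:E) indicE mem_set// mulr1.
Qed.

Lemma integral_ae_eq_nonneg f g : (forall x, 0 <= f x)%E ->
  (forall x, 0 <= g x)%E -> {ae mu, forall x, f x = g x} ->
  (\int[mu]_x f x = \int[mu]_x g x)%E.
Proof.
move=> f0 g0 fg; apply/eqP; rewrite eq_le !le_integral_ae_nonneg//.
by apply: filterS fg => x ->.
Qed.

Lemma ae_eq_posneg f g : {ae mu, forall x, f x = g x} ->
  {ae mu, forall x, (f^\+ x = g^\+ x)%E} /\ {ae mu, forall x, (f^\- x = g^\- x)%E}.
Proof.
by move=> fg; split; apply: filterS fg => x e;
  rewrite ?funeposE ?funenegE e.
Qed.

Lemma integral_ae_eq_nonmeasurable f g : {ae mu, forall x, f x = g x} ->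
  (\int[mu]_x f x = \int[mu]_x g x)%E.
Proof.
move=> /ae_eq_posneg[fgp fgn]; rewrite integralE [in RHS]integralE.
by congr (_ - _)%E; apply: integral_ae_eq_nonneg.
Qed.

Let cT := g_sigma_algebraType (completed_algebra_gen mu).

Lemma measurable_completed (A : set T) : measurable A -> measurable (A : set cT).
Proof.
move=> mA; apply: sub_sigma_algebra; exists A => //; exists set0; last by rewrite setU0.
exact: negligible_set0.
Qed.

Lemma negligible_completed (A : set T) : mu.-negligible A -> measurable (A : set cT).
Proof.
move=> nA; apply: sub_sigma_algebra; exists set0 => //; exists A => //.
by rewrite set0U.
Qed.

Lemma measurable_mu_measurable f : measurable_fun setT f -> mu_measurable mu f.
Proof.
move=> mf _ B mB; rewrite setTI; apply: measurable_completed.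
by rewrite -[X in measurable X]setTI; exact: mf.
Qed.

Lemma mu_measurable_ae f g : {ae mu, forall x, f x = g x} ->
  mu_measurable mu f -> mu_measurable mu g.
Proof.
move=> [N [mN N0 NP]] mf _ B mB; rewrite setTI.
have fg x : ~ N x -> f x = g x by move=> Nx; apply: contrapT => /NP.
have -> : g @^-1` B = (f @^-1` B `\` N) `|` (g @^-1` B `&` N).
  apply/seteqP; split => x.
    by have [Nx|Nx] := pselect (N x); [right|left; split => //=; rewrite fg].
  by move=> [[/= fB Nx]|[]//]; rewrite -fg.
apply: (@measurableU _ cT).
  apply: (@measurableD _ cT); last exact: measurable_completed.
  by have := mf measurableT B mB; rewrite setTI.
by apply: negligible_completed; exists N; split.
Qed.

Lemma integral_defined_ae f g : {ae mu, forall x, f x = g x} ->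
  integral_defined mu f -> integral_defined mu g.
Proof.
move=> fg [mf fin]; split; first exact: mu_measurable_ae mf.
have [fgp fgn] := ae_eq_posneg fg.
by rewrite -(integral_ae_eq_nonmeasurable fgp) -(integral_ae_eq_nonmeasurable fgn).
Qed.

(** The sets that agree with a measurable set off a null set form a sigma-algebra containing the
    generators of the completion. *)
Lemma completed_measurableP (A : set cT) : measurable A ->
  exists B N : set T, [/\ measurable B, measurable N, mu N = 0%E
    & forall x, ~ N x -> (A x <-> B x)].
Proof.
move: A; apply: smallest_sub => /=.
  split.
  - by exists set0, set0; split.
  - move=> A [B [N [mB mN N0 AB]]]; exists (~` B), N; split => //.
      exact: measurableC.
    by move=> x Nx; rewrite setTD /=; have [h1 h2] := AB x Nx; split;
      apply: contra_not.
  - move=> A HA; have [B HB] := choice HA; have [N HN] := choice HB.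
    exists (\bigcup_n B n), (\bigcup_n N n); split.
    + by apply: bigcupT_measurable => n; have [] := HN n.
    + by apply: bigcupT_measurable => n; have [] := HN n.
    + have h : mu.-negligible (\bigcup_n N n).
        apply: negligible_bigcup => n; exists (N n); split => //; by have [] := HN n.
      apply: measure_negligible => //.
      by apply: bigcupT_measurable => n; have [] := HN n.
    + move=> x Nx; have AB n : A n x <-> B n x.
        by have [_ _ _] := HN n; apply => Nn; apply: Nx; exists n.
      by split => -[n _ /AB h]; exists n.
move=> _ [/= B mB [M [N [mN N0 MN]] <-]]; exists B, N; split => // x Nx.
by split => [[//|/MN]//|]; left.
Qed.

(** Each rational sublevel set of [f] is measurable up to a null set. With [f] replaced by 0 on the
    union [M] of these null sets, the sublevel sets become measurable, and rational levels
    suffice. *)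
Lemma mu_measurable_version f : mu_measurable mu f ->
  exists g, measurable_fun setT g /\ {ae mu, forall x, f x = g x}.
Proof.
move=> mf.
have lvl (q : rat) : exists BN : set T * set T, [/\ measurable BN.1, measurable BN.2,
    mu BN.2 = 0%E & forall x, ~ BN.2 x -> ((f x < (ratr q)%:E)%E <-> BN.1 x)].
  have mq : measurable ([set x | (f x < (ratr q)%:E)%E] : set cT).
    have := mf measurableT `]-oo, (ratr q)%:E[%classic (emeasurable_itv _).
    rewrite setTI; congr measurable; apply/seteqP; split => x /=;
      by rewrite in_itv.
  by have [B [N [*]]] := completed_measurableP mq; exists (B, N).
have [BN HBN] := choice lvl.
pose M := \bigcup_(q : rat) (BN q).2.
have mM : measurable M.
  by apply: countable_bigcupT_measurable => // q; have [] := HBN q.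
have M0 : mu M = 0%E.
  pose e (n : nat) := if unpickle n is Some q then (BN q).2 else set0.
  have -> : M = \bigcup_n e n.
    have eE q : e (pickle q) = (BN q).2 by rewrite /e pickleK.
    apply/seteqP; split => x [q _ Bx].
      by exists (pickle q); [exact: I|rewrite eE].
    by move: Bx; rewrite /e; case: unpickle => // q' Bx; exists q'.
  have me n : measurable (e n).
    by rewrite /e; case: unpickle => // q; have [] := HBN q.
  have h : mu.-negligible (\bigcup_n e n).
    apply: negligible_bigcup => n; exists (e n); split => //.
    by rewrite /e; case: unpickle => [q|]; [have [] := HBN q|rewrite measure0].
  by apply: measure_negligible => //; exact: bigcupT_measurable.
pose g x := if pselect (M x) then 0%E else f x.
exists g; split; last first.
  exists M; split => // x /= H; apply: contrapT => nMx; apply: H.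
  by rewrite /g; case: pselect.
have mg (q : rat) : measurable [set x | (g x < (ratr q)%:E)%E].
  have -> : [set x | (g x < (ratr q)%:E)%E] =
      ((BN q).1 `\` M) `|` (M `&` [set x | (0 < ratr q :> R)]).
    apply/seteqP; split => x /=; rewrite /g; case: pselect => Mx /=.
    - by move=> h; right; split => //; rewrite -lte_fin.
    - move=> h; left; split => //; have [_ _ _ <-//] := HBN q.
      by move=> Bx; apply: Mx; exists q.
    - by move=> [[]//|[_]]; rewrite lte_fin.
    - move=> [[Bx _]|[]//]; have [_ _ _ H] := HBN q.
      by apply/H => //; move=> B2; apply: Mx; exists q.
  apply: measurableU; first by apply: measurableD => //; have [] := HBN q.
  apply: measurableI => //.
  have [q0|q0] := boolP (0 < ratr q :> R).
    by rewrite (_ : [set _ | _] = setT)//; apply/seteqP; split.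
  by rewrite (_ : [set _ | _] = set0)//; apply/seteqP; split.
apply: (measurability _ (ErealGenInftyO.measurableE R)) => _ [_ [t ->] <-].
rewrite setTI.
have -> : g @^-1` `]-oo, t%:E[%classic =
    \bigcup_(q : rat) (if (ratr q <= t :> R) then [set x | (g x < (ratr q)%:E)%E] else set0).
  apply/seteqP; split => x /=; rewrite in_itv/=.
    move=> gt; have [q [gq qt]] : exists q : rat, (g x < (ratr q)%:E)%E /\ ratr q <= t.
      move: gt; case: (g x) => [r| |]//.
        rewrite lte_fin => rt; have [q] := rat_in_itvoo rt.
        by rewrite in_itv/= => /andP[rq qt]; exists q; rewrite lte_fin; split => //; exact: ltW.
      move=> _; have [q] := @rat_in_itvoo R (t - 1) t ltac:(lra).
      by rewrite in_itv/= => /andP[rq qt]; exists q; rewrite ltNyr; split => //; exact: ltW.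
    by exists q => //; rewrite qt.
  by move=> [q _]; case: ifPn => // qt /= /lt_le_trans; apply; rewrite lee_fin.
apply: countable_bigcupT_measurable => // q; case: ifPn => // _; exact: mg.
Qed.

End ae_nonmeasurable.

(** * From Monge to Kantorovich *)

(** Positive and negative parts are matched separately, so the identity holds also for integrals
    that are not finite. *)
Lemma integral_pushforward_measurable d d' (T : measurableType d) (V : measurableType d')
    (R : realType) (m : {measure set T -> \bar R}) (X : T -> V) (f : V -> \bar R) :
  measurable_fun setT X -> measurable_fun setT f ->
  (\int[pushforward m X]_v f v = \int[m]_x f (X x))%E.
Proof.
move=> mX mf; rewrite [in LHS]integralE [in RHS]integralE; congr (_ - _)%E.
  rewrite (ge0_integral_pushforward mX)//; last exact: measurable_funepos.
  by apply: eq_integral => x _; rewrite /= !funeposE.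
rewrite (ge0_integral_pushforward mX)//; last exact: measurable_funeneg.
by apply: eq_integral => x _; rewrite /= !funenegE.
Qed.

Lemma bounded_fun_normr_le (T : Type) (R : realType) (f : T -> R) : bounded_fun f ->
  exists M, forall x, `|f x| <= M.
Proof.
by move=> [M [_ fM]]; exists (M + 1) => x; apply: fM => //; rewrite ltrDl.
Qed.

Section monge_to_kantorovich.
Context (R : realType) (X Y : ptopologicalType) (d : nat).
Context (mu : probability (borel X) R) (nu : probability (borel Y) R).
Context (F : {mfun borel Y >-> borel 'rV[R]_d}).
Context (h : borel (X * 'rV[R]_d)%type -> R).
Hypothesis sX : souslin R X.
Hypothesis sY : souslin R Y.

Local Notation U := (unit_uniform R).
Local Notation m := (mu \x unit_uniform R)%E.

Section plan.
Context (H : borel X * measurableTypeR R -> borel Y).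
Hypothesis mH : measurable_fun setT H.
Hypothesis H_law : forall g : borel Y -> \bar R, measurable_fun setT g ->
  (forall y, 0 <= g y)%E -> (\int[m]_z g (H z) = \int[nu]_y g y)%E.

(** The target carries the Borel sets of the product topology; its open sets are measurable
    rectangles up to countable union because both spaces are Souslin. *)
Lemma measurable_graph : measurable_fun setT
  ((fun z => (z.1, H z)) : borel X * measurableTypeR R -> borel (X * Y)%type).
Proof.
apply: measurable_fun_generated => V oV.
have mV : measurable (V : set (borel X * borel Y)).
  by apply: lindelof_prod_open_measurable => //; exact: souslin_prod_lindelof sX sY.
have mG : measurable_fun setT ((fun z => (z.1, H z)) :
    borel X * measurableTypeR R -> borel X * borel Y).
  apply/measurable_fun_pairP; split; last exact: mH.
  exact: measurable_fst.
by rewrite -[X in measurable X]setTI; exact: mG.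
Qed.

Lemma measurable_fiber x : measurable_fun setT (fun u => H (x, u)).
Proof. exact: measurableT_comp mH (pair1_measurable x). Qed.

Definition plan : probability (borel (X * Y)%type) R :=
  distribution m (mfun_Sub (mem_set measurable_graph)).

Definition fiber (x : X) : probability (borel Y) R :=
  distribution U (mfun_Sub (mem_set (measurable_fiber x))).

Lemma plan_transport : transport_plan mu nu plan.
Proof.
split=> [A mA|B mB].
  rewrite /pushforward /plan /distribution /pushforward /=.
  rewrite (_ : _ @^-1` _ = A `*` setT); last by apply/seteqP; split => z //= [].
  by rewrite product_measure1E// -[RHS]mule1; congr (_ * _)%E; exact: probability_setT.
transitivity (m (H @^-1` B)); first by [].
have mHB : measurable (H @^-1` B) by rewrite -[X in measurable X]setTI; exact: mH.
have mB1 : measurable_fun setT (fun y : borel Y => (\1_B y : R)%:E).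
  by apply/measurable_EFinP; exact: measurable_indic.
have e := @integral_indic _ _ _ m setT measurableT _ mHB; rewrite setIT in e.
have e' : (\int[nu]_y (\1_B y : R)%:E = nu B)%E by rewrite integral_indic// setIT.
by rewrite -e -e'; apply: (H_law mB1) => y; rewrite lee_fin.
Qed.

Lemma plan_disintegration : disintegration mu plan fiber.
Proof.
split=> [B mB|phi psi mphi mpsi /bounded_fun_normr_le[M bphi] /bounded_fun_normr_le[N bpsi]].
  apply: measurable_mu_measurable.
  have mHB : measurable (H @^-1` B) by rewrite -[X in measurable X]setTI; exact: mH.
  have := measurable_fun_xsection U mHB.
  apply: eq_measurable_fun => x _; rewrite /fiber /distribution /pushforward /=.
  by rewrite xsectionE.
have mfst : measurable_fun setT (fst : borel (X * Y)%type -> borel X).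
  apply: measurable_fun_generated => V oV; apply: sub_sigma_algebra.
  by apply: open_comp => // z _; exact: cvg_fst.
have msnd : measurable_fun setT (snd : borel (X * Y)%type -> borel Y).
  apply: measurable_fun_generated => V oV; apply: sub_sigma_algebra.
  by apply: open_comp => // z _; exact: cvg_snd.
have mpp : measurable_fun setT
    (fun z : borel (X * Y)%type => (phi z.1 * psi z.2)%:E).
  apply/measurable_EFinP; apply: measurable_funM.
    exact: measurableT_comp mphi mfst.
  exact: measurableT_comp mpsi msnd.
rewrite (integral_pushforward_measurable m measurable_graph mpp).
rewrite -integral12_prod_meas1; last first.
  have mH' : measurable_fun setT (fun z => phi z.1 * psi (H z)).
    apply: measurable_funM; last exact: measurableT_comp mpsi mH.
    exact: measurableT_comp mphi measurable_fst.
  pose mP : probability (borel X * measurableTypeR R)%type R := m.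
  have hb : rintegrable mP (fun z => phi z.1 * psi (H z)).
    apply: (@bounded_rintegrable _ _ _ mP); split=> //; exists (M * N) => z; rewrite normrM.
    by apply: ler_pM.
  exact: hb.
apply: eq_integral => x _; rewrite /fubini_F /=.
rewrite (integral_pushforward_measurable U (measurable_fiber x))//.
by apply/measurable_EFinP; apply: measurable_funM.
Qed.

Lemma barycenter_fiber x :
  barycenter F (fiber x) =
  \row_i fine (\int[U]_u (F (H (x, u)) ord0 i)%:E)%E.
Proof.
apply/rowP => i; rewrite !mxE /Rintegral; congr fine.
rewrite (integral_pushforward_measurable U (measurable_fiber x))//.
by apply/measurable_EFinP; exact: measurable_mfun_coord.
Qed.

End plan.

Lemma monge_to_kantorovich (T : {mfun borel X >-> borel 'rV[R]_d}) :
  monge_admissible mu nu F h T ->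
  exists2 sk, kantorovich_admissible mu nu F h sk &
    kantorovich_cost mu F h sk = monge_cost mu h T.
Proof.
move=> [TF hT]; have [/finite_first_momentP iT /finite_first_momentP iF _] := TF.
have [s [q [D [ms mq s01 [mD nuD] sqD]]]] := souslin_code nu sY.
have [H [mH H_law TH]] := coupling_kernel (T := fun x i => T x ord0 i)
  (F := fun y i => F y ord0 i) iT iF (convex_order_affine_le TF) ms mq s01 mD nuD sqD.
pose sk := (plan mH, fiber mH).
have aeT : {ae mu, forall x, integrand h T x = integrand h (kantorovich_map F sk) x}.
  have : {ae mu, forall x i, (T x ord0 i)%:E =
      (\int[U]_u (F (H (x, u)) ord0 i)%:E)%E}.
    by apply: filter_forall => i; exact: TH.
  apply: filterS => x Tx; rewrite /integrand /kantorovich_map /=.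
  congr (h (x, _))%:E; rewrite barycenter_fiber; apply/rowP => i.
  by rewrite mxE -Tx.
exists sk; last by apply/esym; exact: integral_ae_eq_nonmeasurable.
split; [exact: plan_transport|exact: plan_disintegration|].
exact: integral_defined_ae aeT hT.
Qed.

End monge_to_kantorovich.

(** * From Kantorovich to Monge *)

Lemma rintegral_sum dT (T : measurableType dT) (R : realType)
    (m : {finite_measure set T -> \bar R}) n (f : 'I_n -> T -> R) :
  (forall i, rintegrable m (f i)) ->
  \int[m]_x (\sum_i f i x) = \sum_i \int[m]_x f i x.
Proof.
elim: n f => [|n IH] f intf.
  by under eq_Rintegral do rewrite big_ord0; rewrite Rintegral_cst// mul0r big_ord0.
under eq_Rintegral do rewrite big_ord_recl -[X in X + _]mul1r.
rewrite rintegral_lin//; last exact: rintegrable_sum.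
by rewrite mul1r big_ord_recl IH.
Qed.

(** The affine minorant of [phi] that touches it at the mean [t] has integral [phi t]. *)
Lemma convex_jensen dO (O : measurableType dO) (R : realType) (P : probability O R)
    d (Z : {mfun O >-> borel 'rV[R]_d}) (phi : 'rV[R]_d -> R) :
  (forall i, rintegrable P (fun x => Z x ord0 i)) ->
  rintegrable P (phi \o Z) ->
  convex_function [set: convex_lmodType 'rV[R]_d] phi ->
  phi (\row_i \int[P]_x Z x ord0 i) <= \int[P]_x phi (Z x).
Proof.
move=> iZ iphi cphi; set t := \row_i _.
have [c Hc] := convex_subgradient t cphi.
have ic i : rintegrable P (fun x => c i * Z x ord0 i + - (c i * t ord0 i)).
  by apply: rintegrable_lin => //; exact: rintegrable_cst.
have isum : rintegrable P (fun x => 1 * (\sum_i (c i * Z x ord0 i + - (c i * t ord0 i))) + phi t).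
  by apply: rintegrable_lin; [exact: rintegrable_sum|exact: rintegrable_cst].
have P1 r : \int[P]_x r = r.
  by rewrite Rintegral_cst// [X in fine X](probability_setT P) mulr1.
have -> : phi t =
    \int[P]_x (1 * (\sum_i (c i * Z x ord0 i + - (c i * t ord0 i))) + phi t).
  rewrite rintegral_lin; [|exact: rintegrable_sum|exact: rintegrable_cst].
  rewrite rintegral_sum// P1 big1 ?mulr0 ?add0r// => i _.
  rewrite rintegral_lin//; last exact: rintegrable_cst.
  by rewrite P1 mxE subrr.
apply: le_Rintegral => // x _; apply: le_trans (Hc (Z x)).
rewrite mul1r addrC lerD2l le_eqVlt; apply/orP; left; apply/eqP.
by apply: eq_bigr => i _; rewrite mulrBr.
Qed.

Section kantorovich_to_monge.
Context (R : realType) (X Y : ptopologicalType) (d : nat).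
Context (mu : probability (borel X) R) (nu : probability (borel Y) R).
Context (F : {mfun borel Y >-> borel 'rV[R]_d}).
Context (h : borel (X * 'rV[R]_d)%type -> R).
Context (s : probability (borel (X * Y)%type) R) (k : X -> probability (borel Y) R).
Hypothesis s_plan : transport_plan mu nu s.
Hypothesis sk : disintegration mu s k.

(** Over the completed sigma-algebra the conditional measures form a kernel. *)
Lemma disintegration_mu_measurable (g : borel Y -> \bar R) :
  measurable_fun setT g -> (forall y, 0 <= g y)%E ->
  mu_measurable mu (fun x => \int[k x]_y g y)%E.
Proof.
move=> mg g0.
apply: (@measurable_fun_integral_kernel _ _ (g_sigma_algebraType (completed_algebra_gen mu))
  (borel Y) R (fun x => k x)) => // B mB.
exact: sk.1.
Qed.

Lemma disintegration_bounded (g : borel Y -> R) : measurable_fun setT g ->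
  (exists M, forall y, 0 <= g y <= M) ->
  (\int[mu]_x \int[k x]_y (g y)%:E = \int[nu]_y (g y)%:E)%E.
Proof.
move=> mg [M gM].
have bg : bounded_fun g.
  exists M; split; first exact: num_real.
  move=> N MN y _ /=; have /andP[g0 gy] := gM y.
  by rewrite ger0_norm// (le_trans gy)// ltW.
have b1 : bounded_fun ((fun=> 1) : borel X -> R).
  exists 1; split; first exact: num_real.
  by move=> N N1 y _ /=; rewrite normr1 ltW.
have := sk.2 (fun=> 1) g (measurable_cst _) mg b1 bg.
under [X in _ = X -> _]eq_integral do under eq_integral do rewrite mul1r.
move=> <-; under eq_integral do rewrite mul1r.
have msnd : measurable_fun setT (snd : borel (X * Y)%type -> borel Y).
  apply: measurable_fun_generated => V oV; apply: sub_sigma_algebra.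
  by apply: open_comp => // z _; exact: cvg_snd.
have mG : measurable_fun setT (EFin \o g) by exact/measurable_EFinP.
rewrite -(integral_pushforward_measurable s msnd mG).
by apply: eq_measure_integral => B mB _; have [_ h2] := s_plan; exact: h2.
Qed.

(* The disintegration formula only applies to bounded functions, hence the
   truncations. *)
Lemma disintegration_ge0 (g : borel Y -> R) : measurable_fun setT g ->
  (forall y, 0 <= g y) -> exists G : borel X -> \bar R,
  [/\ measurable_fun setT G, forall x, (0 <= G x)%E,
      {ae mu, forall x, \int[k x]_y (g y)%:E = G x}
    & \int[mu]_x G x = \int[nu]_y (g y)%:E]%E.
Proof.
move=> mg g0.
pose gn n y := Num.min (g y) n%:R.
have gn0 n y : 0 <= gn n y by rewrite le_min g0 ler0n.
have mgn n : measurable_fun setT (gn n) by exact: measurable_minr.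
have mgnE n : measurable_fun setT (fun y => (gn n y)%:E).
  exact/measurable_EFinP.
have ndgn y : nondecreasing_seq (fun n => (gn n y)%:E).
  move=> i j ij; rewrite lee_fin /gn le_min ge_min lexx/=.
  by rewrite ge_min (_ : i%:R <= j%:R) ?orbT// ler_nat.
have lim_gn y : limn (fun n => (gn n y)%:E) = (g y)%:E.
  apply/cvg_lim => //; apply: cvg_near_cst.
  exists (Num.truncn (g y)).+1 => // n /= gyn; congr EFin; apply/min_idPl.
  by rewrite ltW// (lt_le_trans (truncnS_gt _))// ler_nat.
have mcvg (m : {measure set (borel Y) -> \bar R}) :
    (\int[m]_y (g y)%:E = limn (fun n => \int[m]_y (gn n y)%:E))%E.
  rewrite -monotone_convergence//.
  - by apply: eq_integral => y _; rewrite lim_gn.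
  - by move=> n y _; rewrite lee_fin.
have /choice[G HG] n : exists G : borel X -> \bar R,
    [/\ measurable_fun setT G, forall x, (0 <= G x)%E &
     {ae mu, forall x, \int[k x]_y (gn n y)%:E = G x}]%E.
  have [|G [mG aeG]] := @mu_measurable_version _ _ _ mu (fun x => \int[k x]_y (gn n y)%:E)%E.
    by apply: disintegration_mu_measurable => // y; rewrite lee_fin.
  exists (fun x => maxe (G x) 0); split.
  - exact: measurable_maxe.
  - by move=> x; rewrite le_max lexx orbT.
  - apply: filterS aeG => x <-; apply/esym/max_idPl.
    by apply: integral_ge0 => y _; rewrite lee_fin.
have aeG : {ae mu, forall x, forall n, \int[k x]_y (gn n y)%:E = G n x}%E.
  by apply/ae_foralln => n; have [_ _] := HG n.
have [N [mN N0 NP]] := aeG.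
have GE x n : ~ N x -> (\int[k x]_y (gn n y)%:E = G n x)%E.
  by move=> Nx; apply: contrapT => H; apply: Nx; apply: NP => /(_ n).
(* Setting all versions to 0 on one null set makes the sequence nondecreasing at every [x], as
   monotone convergence asks. *)
pose G' n x : \bar R := (G n x * (\1_(~` N) x)%:E)%E.
have G'N n x : N x -> G' n x = 0%E.
  by move=> Nx; rewrite /G' indicE memNset ?mule0// => /(_ Nx).
have G'E n x : ~ N x -> G' n x = (\int[k x]_y (gn n y)%:E)%E.
  by move=> Nx; rewrite /G' indicE mem_set// mule1 GE.
have mG' n : measurable_fun setT (G' n).
  apply: emeasurable_funM; first by have [] := HG n.
  by apply/measurable_EFinP; apply: measurable_indic; exact: measurableC.
have G'0 n x : (0 <= G' n x)%E.
  have [Nx|Nx] := pselect (N x); first by rewrite G'N.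
  by rewrite G'E//; apply: integral_ge0 => y _; rewrite lee_fin.
have ndG' x : nondecreasing_seq (G' ^~ x).
  move=> i j ij; have [Nx|Nx] := pselect (N x); first by rewrite !G'N.
  rewrite !G'E//; apply: ge0_le_integral => //.
  - by move=> y _; rewrite lee_fin.
  - by move=> y _; exact: ndgn.
exists (fun x => limn (G' ^~ x)); split.
- apply: (emeasurable_fun_cvg G') => // x _.
  by apply: ereal_nondecreasing_is_cvgn.
- move=> x; apply: lime_ge; first exact: ereal_nondecreasing_is_cvgn.
  exact: nearW.
- exists N; split => // x /= H; apply: contrapT => Nx; apply: H.
  by rewrite mcvg; congr (limn _); apply/funext => n; rewrite G'E.
- rewrite monotone_convergence//.
  rewrite mcvg; congr (limn _); apply/funext => n.
  rewrite -disintegration_bounded//; last first.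
    by exists n%:R => y; rewrite gn0/= /gn ge_min lexx orbT.
  apply: integral_ae_eq_nonmeasurable; exists N; split => // x /= H.
  by apply: contrapT => Nx; apply: H; rewrite G'E.
Qed.

(** The version [G] of the conditional integrals has a finite integral, so it is finite almost
    everywhere, and where it is finite [g] is integrable for [k x]. *)
Lemma disintegration_mean_ge0 (g : borel Y -> R) : rintegrable nu g ->
  (forall y, 0 <= g y) -> exists S : borel X -> R,
  [/\ rintegrable mu S, \int[mu]_x S x = \int[nu]_y g y
    & {ae mu, forall x, rintegrable (k x) g /\ \int[k x]_y g y = S x}].
Proof.
move=> ig g0; have mg : measurable_fun setT g.
  by have := measurable_int _ ig => /measurable_EFinP.
have [G [mG G0 aeG intG]] := disintegration_ge0 mg g0.
have Gint : mu.-integrable setT G.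
  apply/integrableP; split => //; rewrite (eq_integral G); last first.
    by move=> x _; rewrite gee0_abs.
  rewrite intG; have /integrableP[_] := ig.
  rewrite (eq_integral (fun y => (g y)%:E))// => y _.
  by rewrite /= ger0_norm.
have Gfin := integrable_ae measurableT Gint.
have SE : {ae mu, forall x, (fine (G x))%:E = G x}.
  by apply: filterS Gfin => x /(_ I); exact: fineK.
exists (fun x => fine (G x)); split.
- apply/integrableP; split.
    by apply/measurable_EFinP; exact: measurableT_comp.
  rewrite (@integral_ae_eq_nonmeasurable _ _ _ mu _ G).
    have /integrableP[_] := Gint; rewrite (eq_integral G)// => x _.
    by rewrite gee0_abs.
  by apply: filterS SE => x /= e; rewrite ger0_norm// fine_ge0.
- by rewrite /Rintegral (integral_ae_eq_nonmeasurable SE) intG.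
- apply: filterS2 Gfin aeG => x /(_ I) Gx e.
  have eG : (\int[k x]_y (g y)%:E)%E = G x by exact: e.
  split; last by rewrite /Rintegral eG.
  apply/integrableP; split; first exact/measurable_EFinP.
  rewrite (eq_integral (fun y => (g y)%:E)); last first.
    by move=> y _; rewrite /= ger0_norm.
  by rewrite eG -ge0_fin_numE.
Qed.

Lemma disintegration_mean (f : borel Y -> R) : rintegrable nu f ->
  exists S : borel X -> R,
  [/\ rintegrable mu S, \int[mu]_x S x = \int[nu]_y f y
    & {ae mu, forall x, rintegrable (k x) f /\ \int[k x]_y f y = S x}].
Proof.
move=> jf; have mf : measurable_fun setT f.
  by have := measurable_int _ jf => /measurable_EFinP.
have ip : rintegrable nu f^\+.
  apply: (rintegrable_le (measurable_funrpos mf) (integrable_abse jf)) => y /=.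
  by rewrite (ger0_norm (funrpos_ge0 _ _)) /funrpos ge_max ler_norm normr_ge0.
have im : rintegrable nu f^\-.
  apply: (rintegrable_le (measurable_funrneg mf) (integrable_abse jf)) => y /=.
  by rewrite (ger0_norm (funrneg_ge0 _ _)) /funrneg ge_max -normrN ler_norm normr_ge0.
have fE y : f y = (-1) * f^\- y + f^\+ y.
  by rewrite -[in LHS](funrposBneg f) mulN1r addrC.
have [Sp [iSp eSp aeSp]] := disintegration_mean_ge0 ip (funrpos_ge0 f).
have [Sm [iSm eSm aeSm]] := disintegration_mean_ge0 im (funrneg_ge0 f).
exists (fun x => (-1) * Sm x + Sp x); split; first exact: rintegrable_lin.
  rewrite rintegral_lin// eSp eSm -rintegral_lin//.
  by apply: eq_Rintegral => y _; rewrite -fE.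
have FF : Filter (almost_everywhere mu) by apply: ae_filter_ringOfSetsType.
apply: filterS2 aeSp aeSm => x [ikp ekp] [ikm ekm].
have -> : f = (fun y => (-1) * f^\- y + f^\+ y) by exact/funext.
split; first exact: rintegrable_lin.
by rewrite rintegral_lin// ekp ekm.
Qed.

Hypothesis iF : vintegrable F nu.
Hypothesis hsk : integral_defined mu (integrand h (kantorovich_map F (s, k))).

Lemma kantorovich_to_monge : exists2 T, monge_admissible mu nu F h T &
  monge_cost mu h T = kantorovich_cost mu F h (s, k).
Proof.
have FF : Filter (almost_everywhere mu) by apply: ae_filter_ringOfSetsType.
have /choice[S HS] i := disintegration_mean (iF i).
(* The [S i] are Borel versions of the coordinates of the barycenter, which itself is known to be
   measurable only up to null sets. *)
pose T0 x : 'rV[R]_d := \row_i S i x.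
have mT0 : measurable_fun setT (T0 : borel X -> borel 'rV[R]_d).
  apply: measurable_row => i; have [iS _ _] := HS i.
  have /measurable_EFinP mS := measurable_int _ iS.
  by apply: eq_measurable_fun mS => x _; rewrite mxE.
pose T : {mfun borel X >-> borel 'rV[R]_d} := mfun_Sub (mem_set mT0).
have aeS : {ae mu, forall x i, rintegrable (k x) (fun y => F y ord0 i) /\
    \int[k x]_y F y ord0 i = S i x}.
  by apply: filter_forall => i; have [_ _] := HS i.
have aeT : {ae mu, forall x, barycenter F (k x) = T x}.
  by apply: filterS aeS => x Sx; apply/rowP => i; rewrite !mxE; have [_ ->] := Sx i.
have aeI : {ae mu, forall x, integrand h (kantorovich_map F (s, k)) x = integrand h T x}.
  by apply: filterS aeT => x e; rewrite /integrand /kantorovich_map /= e.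
exists T; last by apply/esym; exact: integral_ae_eq_nonmeasurable.
split; last exact: integral_defined_ae aeI hsk.
split.
- apply/finite_first_momentP => i; have [iS _ _] := HS i.
  rewrite (_ : (fun x => T x ord0 i) = S i)//.
  by apply/funext => x; rewrite mxE.
- exact/finite_first_momentP.
move=> phi cphi iphi.
have mphi : measurable_fun setT (phi : borel 'rV[R]_d -> R).
  by have /measurable_EFinP := measurable_int _ iphi.
have mphiE : measurable_fun setT (EFin \o phi : borel 'rV[R]_d -> \bar R).
  exact/measurable_EFinP.
have iphiF : rintegrable nu (phi \o F) by exact/(integrable_distribution nu F mphi).
have [V [iV eV aeV]] := disintegration_mean iphiF.
have mV := measurable_int _ iV.
rewrite (integral_pushforward_measurable mu mT0 mphiE).
rewrite (integral_pushforward_measurable nu (measurable_funPT F) mphiE).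
have -> : (\int[nu]_y (EFin \o phi) (F y) = \int[mu]_x (V x)%:E)%E.
  rewrite -[LHS]fineK; last exact: (integrable_fin_num measurableT iphiF).
  rewrite -[RHS]fineK; last exact: (integrable_fin_num measurableT iV).
  by congr EFin; exact/esym.
have mphiT : measurable_fun setT (fun x => (phi (T0 x))%:E).
  exact: (measurableT_comp mphiE mT0).
(* Jensen gives [phi (T x) <= V x] only for almost every [x]; the minimum is a version for which the
   order holds everywhere, so that positive and negative parts can be compared without first knowing
   that [phi (T x)] is integrable. *)
rewrite (@integral_ae_eq_nonmeasurable _ _ _ mu _ (fun x => mine (phi (T0 x))%:E (V x)%:E)); last first.
  apply: filterS2 aeV aeS => x [ix <-] Sx; apply/esym/min_idPl.
  rewrite lee_fin; have -> : T0 x = \row_i \int[k x]_y F y ord0 i.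
    by apply/rowP => i; rewrite !mxE; have [_ ->] := Sx i.
  by apply: (convex_jensen (Z := F)) => // i; have [] := Sx i.
have mmin : measurable_fun setT (fun x => mine (phi (T0 x))%:E (V x)%:E).
  exact: measurable_mine.
rewrite integralE [leRHS]integralE; apply: leeB.
- apply: ge0_le_integral => //; [exact: measurable_funepos|exact: measurable_funepos|].
  by move=> x _; rewrite !funeposE ge_max !le_max lexx orbT andbT ge_min lexx orbT.
- apply: ge0_le_integral => //; [exact: measurable_funeneg|exact: measurable_funeneg|].
  by move=> x _; rewrite !funenegE ge_max !le_max lexx orbT andbT leeN2 ge_min lexx orbT.
Qed.

End kantorovich_to_monge.

(** * Equality of the sets of values of the two problems *)

Unset Implicit Arguments.

Theorem theorem4p1 (R : realType) (X Y : ptopologicalType) (d : nat)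
    (mu : probability (borel X) R) (nu : probability (borel Y) R)
    (F : {mfun borel Y >-> borel 'rV[R]_d})
    (h : borel (X * 'rV[R]_d)%type -> R) :
  souslin R X -> souslin R Y ->
  vintegrable F nu ->
  measurable_fun [set: borel (X * 'rV[R]_d)%type] h ->
  ereal_inf [set kantorovich_cost mu F h sk
            | sk in kantorovich_admissible mu nu F h] =
  ereal_inf [set monge_cost mu h T | T in monge_admissible mu nu F h]
  /\
  (has_minimum (kantorovich_admissible mu nu F h) (kantorovich_cost mu F h) <->
   has_minimum (monge_admissible mu nu F h) (fun T => monge_cost mu h T)).
Proof.
move=> sX sY iF _.
have KM sk : kantorovich_admissible mu nu F h sk ->
    exists2 T, monge_admissible mu nu F h T &
      monge_cost mu h T = kantorovich_cost mu F h sk.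
  by case: sk => s k [sp sd hs]; exact: (kantorovich_to_monge sp sd iF hs).
have MK T : monge_admissible mu nu F h T ->
    exists2 sk, kantorovich_admissible mu nu F h sk &
      kantorovich_cost mu F h sk = monge_cost mu h T.
  by move=> hT; exact: (monge_to_kantorovich sX sY hT).
split.
  congr ereal_inf; apply/seteqP; split => _ [i hi <-].
    by have [T hT <-] := KM i hi; exists T.
  by have [sk hsk <-] := MK i hi; exists sk.
split=> -[i hi imin].
  have [T hT eT] := KM i hi; exists T => // T' /MK[sk hsk <-].
  by rewrite eT; exact: imin.
have [sk hsk esk] := MK i hi; exists sk => // sk' /KM[T hT <-].
by rewrite esk; exact: imin.
Qed.
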